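(* Let $G=(V,E)$ be a locally finite weighted graph satisfying the $CD\psi(n,0)$ condition, where $\psi\in C^1(0,+\infty)$ is a concave function with $\psi'(1)>0$, $H_\psi<\infty$ and $\limsup_{\lambda\downarrow0}\frac{\eta_\psi(\lambda)}{\lambda^2}<\infty$. Then the Cheeger constant and the bottom of the spectrum of $-\Delta$ vanish: $h(G)=0$ and $\lambda_0(G)=0$.
   Context: A locally finite weighted graph $G=(V,E)$ here means a connected graph in which every vertex has finitely many neighbours, with a vertex measure $\mu:V\to(0,\infty)$ and symmetric edge weights $w_{xy}=w_{yx}>0$ for $x\sim y$ (adjacent), such that $D_\mu:=\sup_{x}\frac{\deg(x)}{\mu(x)}<\infty$ where $\deg(x)=\sum_{y\sim x}w_{xy}$, $\mu_{\max}:=\sup_x\mu(x)<\infty$, and $w_{\min}:=\inf_{x\sim y}w_{xy}>0$. For $f:V\to\mathbb R$, $\Delta f(x)=\frac1{\mu(x)}\sum_{y\sim x}w_{xy}(f(y)-f(x))$. For $\psi\in C^1(0,\infty)$ and $f:V\to(0,\infty)$: $(\Delta^\psi f)(x)=\Delta\left[\psi\left(\frac{f}{f(x)}\right)\right](x)$. For concave $\psi$ put $\overline\psi(s)=\psi'(1)(s-1)-[\psi(s)-\psi(1)]$ and $\Gamma^\psi(f):=\Delta^{\overline\psi}f$, i.e. $\Gamma^\psi(f)(x)=\frac1{\mu(x)}\sum_{y\sim x}w_{xy}\overline\psi\left(\frac{f(y)}{f(x)}\right)$. Further $$\Omega^\psi f(x)=\Delta\left[\psi'\left(\frac f{f(x)}\right)\frac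 f{f(x)}\left(\frac{\Delta f}{f}-\frac{\Delta f(x)}{f(x)}\right)\right](x),$$ $$2\Gamma_2^\psi(f)=\Omega^\psi(f)+\frac{\Delta f\cdot\Delta^\psi f}{f}-\frac{\Delta(f\cdot\Delta^\psi f)}{f}.$$ For $n>0$ and $\kappa\in\mathbb R$, $G$ satisfies $CD\psi(n,\kappa)$ if for every $f:V\to(0,\infty)$, pointwise on $V$, $\Gamma_2^\psi(f)\ge\frac1n(\Delta^\psi f)^2+\kappa\,\Gamma^\psi(f)$. Constants of $\psi$: $H_\psi:=\sup_{s>1}\frac{(\log s)^2}{\overline\psi(s)}$ and, for $\lambda\ge0$, $\eta_\psi(\lambda):=\max\{\overline\psi(e^{\lambda}),\overline\psi(e^{-\lambda})\}$. Let $\ell^2(V)=\{f:V\to\mathbb R:\sum_x\mu(x)|f(x)|^2<\infty\}$ with $\langle f,g\rangle=\sum_x\mu(x)f(x)g(x)$. The bottom of the spectrum is $\lambda_0(G)=\inf\sigma(-\Delta)=\inf_{0\ne f\in\ell^2(V)}\frac{\langle-\Delta f,f\rangle}{\langle f,f\rangle}$. For finite $\Omega\subset V$ let $w(\partial\Omega)=\sum_{x\in\Omega,\,y\notin\Omega}w_{xy}$ (sum over adjacent pairs), $\mu(\Omega)=\sum_{x\in\Omega}\mu(x)$, and $h(G)=\inf\frac{w(\partial\Omega)}{\mu(\Omega)}$ over all nonempty finite $\Omega\subset V$. *)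

(* Defs.v *)
From HB Require Import structures.
From mathcomp Require Import all_boot all_order all_algebra.
From mathcomp Require Import all_classical all_reals all_analysis.

Set Implicit Arguments.
Unset Strict Implicit.
Unset Printing Implicit Defensive.

Import Order.TTheory GRing.Theory Num.Theory.
Import numFieldNormedType.Exports.

Local Open Scope classical_set_scope.
Local Open Scope ring_scope.

(* [weight x y] is only meaningful for adjacent [x] and [y]: every sum below
   ranges over adjacent pairs.  Loops are not excluded; they contribute nothing
   to the Laplacian. *)
Record weighted_graph (R : realType) (V : choiceType) := WeightedGraph {
  adj : rel V ;
  weight : V -> V -> R ;
  mu : V -> R ;
  vertex_nonempty : [set: V] !=set0 ;
  adj_sym : symmetric adj ;
  weight_sym : forall x y, adj x y -> weight x y = weight y x ;
  weight_gt0 : forall x y, adj x y -> 0 < weight x y ;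
  mu_gt0 : forall x, 0 < mu x ;
  adj_finite : forall x, finite_set [set y | adj x y] ;
  adj_connected : forall x y, exists2 p : seq V, path adj x p & last x p = y
}.

Section Graph.
Context {R : realType} {V : choiceType} (G : weighted_graph R V).
Implicit Types (f g : V -> R) (psi : R -> R) (x y : V).

Definition nbr x : set V := [set y | adj G x y].

Definition deg x : R := \sum_(y \in nbr x) weight G x y.

(* Suprema and infima are taken in the extended reals: [sup] and [inf] in [R]
   return the junk value 0 on unbounded or empty sets. *)
Definition D_mu : \bar R := ereal_sup [set (deg x / mu G x)%:E | x in setT].

Definition mu_max : \bar R := ereal_sup [set (mu G x)%:E | x in setT].

Definition w_min : \bar R :=
  ereal_inf [set (weight G p.1 p.2)%:E | p in [set p : V * V | adj G p.1 p.2]].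

Definition laplacian f x : R :=
  (mu G x)^-1 * \sum_(y \in nbr x) weight G x y * (f y - f x).

Definition laplacian_psi psi f x : R :=
  laplacian (fun y => psi (f y / f x)) x.

Definition psi_bar psi (s : R) : R := derive1 psi 1 * (s - 1) - (psi s - psi 1).

Definition Gamma_psi psi f : V -> R := laplacian_psi (psi_bar psi) f.

Definition Omega_psi psi f x : R :=
  laplacian (fun y => derive1 psi (f y / f x) * (f y / f x)
                      * (laplacian f y / f y - laplacian f x / f x)) x.

Definition Gamma2_psi psi f x : R :=
  (Omega_psi psi f x
   + laplacian f x * laplacian_psi psi f x / f x
   - laplacian (fun y => f y * laplacian_psi psi f y) x / f x) / 2.

Definition CDpsi psi (n kappa : R) : Prop :=
  forall f, (forall x, 0 < f x) -> forall x,
    Gamma2_psi psi f x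
      >= n^-1 * (laplacian_psi psi f x) ^+ 2 + kappa * Gamma_psi psi f x.

Definition l2 : set (V -> R) :=
  [set f | (\esum_(x in [set: V]) (mu G x * `|f x| ^+ 2)%:E < +oo)%E].

(* A series of arbitrary sign is the difference of the sums of its positive and
   negative parts; both are finite for [f] and [g] in [l2]. *)
Definition l2_inner f g : R :=
  let h := fun x => (mu G x * f x * g x)%:E in
  fine (esum [set: V] h^\+%E) - fine (esum [set: V] h^\-%E).

Definition l2_norm f : R := Num.sqrt (l2_inner f f).

Definition neg_laplacian f x : R := - laplacian f x.

(* [-Delta - lambda] is a bijection of [l2] with bounded inverse. *)
Definition resolvent_set : set R :=
  [set lambda |
    let T := fun f x => neg_laplacian f x - lambda * f x in
    set_bij l2 l2 T /\
    exists C : R, forall f, l2 f -> l2_norm f <= C * l2_norm (T f)].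

(* Real spectral parameters suffice, [-Delta] being bounded and self-adjoint
   when [D_mu] is finite. *)
Definition spectrum : set R := ~` resolvent_set.

Definition lambda0 : \bar R := ereal_inf [set l%:E | l in spectrum].

Definition rayleigh_inf : \bar R :=
  ereal_inf [set (l2_inner (neg_laplacian f) f / l2_inner f f)%:E
            | f in [set f | l2 f /\ f <> cst 0]].

Definition boundary_weight (Omega : set V) : R :=
  \sum_(x \in Omega) \sum_(y \in nbr x `\` Omega) weight G x y.

Definition volume (Omega : set V) : R := \sum_(x \in Omega) mu G x.

Definition cheeger : \bar R :=
  ereal_inf [set (boundary_weight Omega / volume Omega)%:E
            | Omega in [set Omega | finite_set Omega /\ Omega !=set0]].

End Graph.

Section Psi.
Context {R : realType} (psi : R -> R).

Definition C1_pos : Prop :=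
  forall s : R, 0 < s -> derivable psi s 1 /\ {for s, continuous (derive1 psi)}.

Definition concave_pos : Prop :=
  convex_function (`]0, +oo[%classic : set R^o) (fun s : R^o => - psi s : R^o).

(* The quotient is the one of the extended reals, where a positive number
   divided by 0 is [+oo]. *)
Definition H_psi : \bar R :=
  ereal_sup [set ((ln s ^+ 2)%:E / (psi_bar psi s)%:E)%E | s in `]1, +oo[].

Definition eta_psi (lambda : R) : R :=
  Num.max (psi_bar psi (expR lambda)) (psi_bar psi (expR (- lambda))).

End Psi.

(* Main.v *)
(** Suppose the Cheeger constant is positive.  Cheeger's inequality makes
    [-Delta - l] positive definite on functions with finite support, for some
    [l > 0], so on every ball there is a function [f >= 1], equal to 1 outside
    the ball, with [Delta f = - l f] inside it.  Put [u = - Delta^psi f].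
    Concavity of [psi] gives [u >= psi'(1) l > 0] inside the ball, and since
    [Delta f / f] is constant there, [Omega^psi f] vanishes and [CDpsi(n, 0)]
    reads
      [1/mu(x) sum_y w_xy f(y)/f(x) (u(y) - u(x)) >= 2/n u(x)^2].
    The coefficients [w_xy f(y) / (mu(x) f(x))] have sum at most [D_mu], so [u]
    gains a fixed amount at some neighbour of each vertex; along a path from
    the centre of a large ball this contradicts the bound on [u] that follows
    from the bounds on [f(y)/f(x)].  Hence [h(G) = 0].

    Indicator functions of finite sets with small [w(boundary)/mu] then show
    that the Rayleigh infimum is 0 and, through
    [|Delta f|^2 <= 2 D <-Delta f, f>], that [-Delta] has no bounded inverse.
    For [l < 0] the resolvent is a Neumann series in the contraction
    [P = 1 + Delta / D] of [l^2]. *)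

Require Import Defs.
From HB Require Import structures.
From mathcomp Require Import all_boot all_order all_algebra.
From mathcomp Require Import finmap all_classical all_reals all_analysis.
From mathcomp Require Import ring lra.

Set Implicit Arguments.
Unset Strict Implicit.
Unset Printing Implicit Defensive.
Import Order.TTheory GRing.Theory Num.Theory.
Import numFieldNormedType.Exports.

Local Open Scope classical_set_scope.
Local Open Scope ring_scope.

(** * Finite networks *)

Section FiniteNetwork.
Variables (R : realFieldType) (I : finType) (k : I -> I -> R) (m : I -> R).
Variable (O : {set I}).
Hypotheses (k_ge0 : forall x y, 0 <= k x y) (k_sym : forall x y, k x y = k y x).
Hypothesis (m_gt0 : forall x, 0 < m x).

(** Discrete co-area argument: [F] is a positive combination of indicators of its superlevel sets,
    all inside [O], and each level contributes one instance of the isoperimetric inequality. The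
    induction is on the size of the support. *)
Lemma coarea_ineq (h : R) (F : I -> R) :
    (forall S : {set I}, S \subset O ->
      h * \sum_(x in S) m x <= \sum_(x in S) \sum_(y in ~: S) k x y) ->
    (forall x, 0 <= F x) -> (forall x, x \notin O -> F x = 0) ->
  h * \sum_x m x * F x <= \sum_x \sum_y k x y * Num.max (F x - F y) 0.
Proof.
move=> iso; have [N] := ubnP #|[set x | F x != 0]%SET|.
elim: N F => // N IHN F; rewrite ltnS => FN F0 FO.
set S := [set x | F x != 0]%SET in FN *.
have [S0|[x0 x0S]] := set_0Vmem S.
  rewrite big1 ?mulr0 => [|x _].
    by do 2!apply: sumr_ge0 => ? _; rewrite mulr_ge0 // le_max lexx orbT.
  by move/setP/(_ x): S0; rewrite !inE => /negbFE/eqP ->; rewrite mulr0.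
have [z zS zmin] : exists2 z, z \in S & forall y, y \in S -> F z <= F y.
  by case: (arg_minP F x0S) => z; exists z.
(* Peel off the lowest level [t] of [F] on its support [S]. *)
set t := F z in zmin.
have Fx0 x : x \notin S -> F x = 0 by rewrite inE negbK => /eqP.
have SO : S \subset O.
  by apply/fintype.subsetP => x; rewrite inE; apply: contraNT => /FO ->.
pose F' x := if x \in S then F x - t else 0.
have F'0 x : 0 <= F' x by rewrite /F'; case: ifP => // /zmin; rewrite subr_ge0.
have {IHN} := IHN F' _ F'0.
have -> : (#|[set x | (F' x != 0)%R]%SET| < N)%N.
  apply: leq_trans FN; apply/proper_card/properP; split.
    by apply/fintype.subsetP => x; rewrite !inE /F';
      case: ifP; rewrite ?eqxx // inE.
  by exists z => //; rewrite inE /F' zS subrr eqxx.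
move=> /(_ isT) IHF'.
have {}IHF' : h * \sum_x m x * F' x
    <= \sum_x \sum_y k x y * Num.max (F' x - F' y) 0.
  apply: IHF' => x xO; rewrite /F'; case: ifP => // xS.
  by rewrite (fintype.subsetP SO) in xO.
have -> : \sum_x m x * F x = t * \sum_(x in S) m x + \sum_x m x * F' x.
  rewrite mulr_sumr [X in _ = X + _]big_mkcond -big_split /=.
  apply: eq_bigr => x _; by rewrite /F'; case: ifPn => [_|/Fx0 ->]; ring.
(* Lowering [F] by [t] on [S] leaves differences inside [S] unchanged and costs [t] on each edge
   leaving [S]; for [x] outside [S] both positive parts are 0. *)
have -> : \sum_x \sum_y k x y * Num.max (F x - F y) 0 =
    t * (\sum_(x in S) \sum_(y in ~: S) k x y)
    + \sum_x \sum_y k x y * Num.max (F' x - F' y) 0.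
  rewrite mulr_sumr [X in _ = X + _]big_mkcond -big_split /=; apply: eq_bigr => x _.
  have [xS|/Fx0 Fx] := ifPn.
    rewrite mulr_sumr [X in _ = X + _]big_mkcond -big_split /=; apply: eq_bigr => y _.
    rewrite finset.in_setC /F' xS; have [yS|yS] := boolP (y \in S) => /=.
      by rewrite add0r; congr (_ * Num.max _ _); ring.
rewrite (Fx0 y) // !subr0 !max_l ?F0 ?subr_ge0 ?zmin //; ring.
  rewrite add0r; apply: eq_bigr => y _; congr (_ * _).
  rewrite Fx /F' [x \in S]inE Fx eqxx /=.
  by have := F'0 y; rewrite /F' => F'y; rewrite !max_r ?sub0r ?oppr_le0.
rewrite mulrDr lerD // mulrCA ler_wpM2l ?F0 //; exact: iso.
Qed.

(** The co-area inequality for [g ^+ 2], with [a^2 - b^2 = (a - b)(a + b)] split by the weighted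
    arithmetic-geometric inequality instead of Cauchy-Schwarz, so that no square roots occur. *)
Lemma cheeger_ineq (h D : R) (g : I -> R) : 0 < h -> 0 < D ->
    (forall S : {set I}, S \subset O ->
      h * \sum_(x in S) m x <= \sum_(x in S) \sum_(y in ~: S) k x y) ->
    (forall x, \sum_y k x y <= D * m x) ->
    (forall x, x \notin O -> g x = 0) ->
  h ^+ 2 * \sum_x m x * g x ^+ 2
    <= 4 * D * \sum_x \sum_y k x y * (g x - g y) ^+ 2.
Proof.
move=> h0 D0 iso kD gO.
have := coarea_ineq iso (fun x => sqr_ge0 (g x)).
have gO2 x : x \notin O -> g x ^+ 2 = 0 by move=> /gO ->; rewrite expr0n.
move=> /(_ gO2); set N := \sum_x m x * g x ^+ 2.
set E := \sum_x \sum_y k x y * (g x - g y) ^+ 2.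
move=> hN.
(* With this parameter the term [t * (2 * D * N)] is half of [h * N] and can be absorbed on the
   left. *)
have t0 : 0 < h / (4 * D) by rewrite divr_gt0 // mulr_gt0.
have ab (t a b : R) : 0 < t ->
    Num.max (a ^+ 2 - b ^+ 2) 0 <= (2 * t)^-1 * (a - b) ^+ 2 + t * (a ^+ 2 + b ^+ 2).
  move=> t1; have tn0 : t != 0 by rewrite gt_eqF.
  rewrite ge_max; apply/andP; split; last first.
    by rewrite addr_ge0 // mulr_ge0 ?invr_ge0 ?sqr_ge0 ?addr_ge0 ?sqr_ge0 //
      ltW ?mulr_gt0.
  rewrite -subr_ge0.
  have -> : (2 * t)^-1 * (a - b) ^+ 2 + t * (a ^+ 2 + b ^+ 2) - (a ^+ 2 - b ^+ 2)
    = (2 * t)^-1 * (((a - b) - t * (a + b)) ^+ 2 + t ^+ 2 * (a - b) ^+ 2).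
    field; by [].
  apply: mulr_ge0; first by rewrite invr_ge0 mulr_ge0 // ltW.
  by apply: addr_ge0; [exact: sqr_ge0 | apply: mulr_ge0; exact: sqr_ge0].
have sumN : \sum_x \sum_y k x y * (g x ^+ 2 + g y ^+ 2) <= 2 * D * N.
  have -> : \sum_x \sum_y k x y * (g x ^+ 2 + g y ^+ 2) =
      2 * \sum_x (\sum_y k x y) * g x ^+ 2.
    transitivity (\sum_x \sum_y k x y * g x ^+ 2 + \sum_x \sum_y k x y * g y ^+ 2).
      rewrite -big_split; apply: eq_bigr => x _; rewrite -big_split.
      by apply: eq_bigr => y _; rewrite mulrDr.
    rewrite [X in _ + X]exchange_big /= mulr_natl mulr2n; congr (_ + _).
      by apply: eq_bigr => x _; rewrite mulr_suml.
    apply: eq_bigr => x _; rewrite mulr_suml.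
    by apply: eq_bigr => y _; rewrite k_sym.
  rewrite -mulrA ler_wpM2l // /N mulr_sumr ler_sum // => x _.
  by rewrite [leRHS]mulrA ler_wpM2r ?sqr_ge0.
have {}hN : h * N <= (2 * (h / (4 * D)))^-1 * E + h / (4 * D) * (2 * D * N).
  apply: le_trans hN _.
  apply: le_trans (lerD (lexx _) (ler_wpM2l (ltW t0) sumN)).
  rewrite /E !mulr_sumr -big_split /= ler_sum // => x _.
  rewrite !mulr_sumr -big_split /= ler_sum // => y _.
  set t := h / (4 * D) in t0 *.
  rewrite [leRHS](_ : _ = k x y * ((2 * t)^-1 * (g x - g y) ^+ 2
                                   + t * (g x ^+ 2 + g y ^+ 2))); last by ring.
  by rewrite ler_wpM2l // ab.
have Dn0 : D != 0 by rewrite gt_eqF.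
have hn0 : h != 0 by rewrite gt_eqF.
have -> : h ^+ 2 * N = 2 * h * (h * N - h / (4 * D) * (2 * D * N)) by field.
have -> : 4 * D * E = 2 * h * ((2 * (h / (4 * D)))^-1 * E).
  by field; rewrite Dn0 hn0.
by rewrite ler_wpM2l ?lerBlDr // mulr_ge0 // ltW.
Qed.

(** Green's formula; the factor 2 appears because the sum runs over ordered pairs. *)
Lemma dirichlet_form (g : I -> R) :
  \sum_x \sum_y k x y * (g x - g y) ^+ 2
  = 2 * \sum_x g x * \sum_y k x y * (g x - g y).
Proof.
have -> : \sum_x \sum_y k x y * (g x - g y) ^+ 2 =
    \sum_x \sum_y k x y * g x * (g x - g y)
    + \sum_x \sum_y k x y * g y * (g y - g x).
  rewrite -big_split; apply: eq_bigr => x _; rewrite -big_split.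
  by apply: eq_bigr => y _ /=; ring.
rewrite [X in _ + X]exchange_big /= mulr_natl mulr2n.
congr (_ + _); apply: eq_bigr => x _; rewrite mulr_sumr; apply: eq_bigr => y _.
  by rewrite -mulrA mulrCA.
by rewrite k_sym -mulrA mulrCA.
Qed.

(* Solving for [g = f - 1], which has zero boundary values, makes positivity of
   [f] a weak maximum principle: [f >= 1]. *)
Lemma dirichlet_positive_solution (l l1 : R) : 0 <= l -> l < l1 ->
    (forall g : I -> R, (forall x, x \notin O -> g x = 0) ->
      l1 * \sum_x m x * g x ^+ 2 <= \sum_x g x * \sum_y k x y * (g x - g y)) ->
  exists f : I -> R, (forall x, 1 <= f x) /\
    (forall x, x \in O -> \sum_y k x y * (f y - f x) = - l * m x * f x).
Proof.
move=> l0 ll1 coer.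
(* Uniqueness principle from the gap [l < l1]. It serves twice: for the injectivity of [L] and for
   the vanishing of the negative part of the solution. *)
have zero g : (forall x, x \notin O -> g x = 0) ->
    \sum_x g x * \sum_y k x y * (g x - g y) <= l * \sum_x m x * g x ^+ 2 ->
    forall x, g x = 0.
  move=> gO /(le_trans (coer _ gO)); rewrite -subr_ge0 -mulrBl.
  rewrite nmulr_rge0 ?subr_lt0 // => N0 x.
  have : \sum_x m x * g x ^+ 2 == 0.
    by rewrite eq_le N0 sumr_ge0 // => y _; rewrite mulr_ge0 ?sqr_ge0 // ltW.
  rewrite psumr_eq0 => [|y _]; last by rewrite mulr_ge0 ?sqr_ge0 // ltW.
  move=> /allP /(_ x); rewrite mem_index_enum => /(_ isT) /=.
  by rewrite mulf_eq0 gt_eqF //= sqrf_eq0 => /eqP.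
(* Being the identity off [O], [L] carries the equation and the boundary values at once; on a
   finite-dimensional space its injectivity gives solvability. *)
pose L (g : {ffun I -> R^o}) : {ffun I -> R^o} := [ffun x =>
  if x \in O then \sum_y k x y * (g x - g y) - l * m x * g x else g x].
have Llin : linear L.
  move=> a u v; apply/ffunP => x; rewrite !ffunE; case: ifP => // _.
  rewrite scalerDr !scaler_sumr.
  under eq_bigr do rewrite !ffunE.
  transitivity (a * (\sum_y k x y * (u x - u y)) + \sum_y k x y * (v x - v y)
     - l * m x * (a * u x + v x)); last first.
    rewrite mulr_sumr /GRing.scale /= ; ring.
  rewrite mulr_sumr -big_split /=; congr (_ - _).
  by apply: eq_bigr => y _; rewrite /GRing.scale /=; ring.
pose Llm : {linear {ffun I -> R^o} -> {ffun I -> R^o}} :=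
  HB.pack L (GRing.isLinear.Build _ _ _ _ L Llin).
pose LL := linfun Llm.
have ker : lker LL == 0%VS.
  apply/lker0P => u v; rewrite !lfunE /= => Luv.
  apply/eqP; rewrite -subr_eq0; apply/eqP/ffunP => x; rewrite [RHS]ffunE.
  have : Llm (u - v) = 0 by rewrite linearB /= Luv subrr.
  move=> /ffunP; set w := u - v => Lw.
  have wO y : y \notin O -> w y = 0.
    by move=> yO; have := Lw y; rewrite /L [LHS]ffunE [RHS]ffunE ifN.
  apply: (zero _ wO); rewrite mulr_sumr ler_sum // => y _.
  have [yO|/wO ->] := boolP (y \in O); last by rewrite mul0r expr0n !mulr0.
  have := Lw y; rewrite /L [LHS]ffunE [RHS]ffunE yO => /subr0_eq ->.
  by rewrite le_eqVlt; apply/orP; left; apply/eqP; ring.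
pose rhs : {ffun I -> R^o} := [ffun x => if x \in O then l * m x else 0].
pose g := (LL^-1)%VF rhs.
have Lg : L g = rhs.
  have := lker0_lfunVK ker rhs; by rewrite lfunE.
have gO x : x \notin O -> g x = 0.
  by move=> xO; have := congr1 (fun u : {ffun _} => u x) Lg; rewrite !ffunE !ifN.
have gE x : x \in O -> \sum_y k x y * (g x - g y) = l * m x * (g x + 1).
  move=> xO; have := congr1 (fun u : {ffun _} => u x) Lg; rewrite !ffunE xO.
  by move=> /eqP; rewrite subr_eq => /eqP ->; ring.
pose p x : R := Num.max (- g x) 0.
have p0 x : 0 <= p x by rewrite le_max lexx orbT.
have pg x : p x = 0 /\ 0 <= g x \/ p x = - g x /\ g x < 0.
  rewrite /p; case: (leP 0 (g x)) => gx; [left|right].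
    by rewrite max_r // oppr_le0.
  by rewrite max_l // oppr_ge0 ltW.
have pz : forall x, p x = 0.
  apply: zero => [x /gO gx|].
    by rewrite /p gx oppr0 maxxx.
  rewrite mulr_sumr ler_sum // => x _.
  have [[-> _]|[px gx]] := pg x; first by rewrite mul0r expr0n !mulr0.
  have xO : x \in O by apply: contraLR gx => /gO ->; rewrite ltxx.
  (* The negative part [p] is tested against the equation: where [p x = - g x], the bound
     [p y >= - g y] gives [p x - p y <= g y - g x]. *)
  apply: (@le_trans _ _ (p x * \sum_y k x y * (g y - g x))).
    rewrite ler_wpM2l // ler_sum // => y _; rewrite ler_wpM2l //.
    by have [[-> ]|[-> ]] := pg y; lra.
  have -> : \sum_y k x y * (g y - g x) = - (l * m x * (g x + 1)).
    by rewrite -gE // -sumrN; apply: eq_bigr => y _; ring.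
  have -> : l * (m x * p x ^+ 2) = p x * (l * m x * p x) by ring.
  rewrite ler_wpM2l // px mulrN mulrDr mulr1 opprD gerDl oppr_le0.
  by rewrite mulr_ge0 // ltW.
exists (fun x => 1 + g x); split=> [x|x /gE gx].
  by have [[_ gx]|[px gx]] := pg x; [lra | have := pz x; lra].
have -> : \sum_y k x y * (1 + g y - (1 + g x)) = - (\sum_y k x y * (g x - g y)).
  by rewrite -sumrN; apply: eq_bigr => y _; ring.
rewrite gx; ring.
Qed.

End FiniteNetwork.

(** * Concave functions on the half-line *)

Section Psi.
Context {R : realType} (psi : R -> R).

Lemma concave_pos_ge (s t : R) : concave_pos psi -> 0 < s -> 0 < t <= 1 ->
  t * (psi s - psi 1) <= psi (1 + t * (s - 1)) - psi 1.
Proof.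
move=> cpsi s0 /andP[t0 t1].
have t01 : Itv.spec (@Itv.num_sem R) (Itv.Real `[0%Z, 1%Z]) t.
  by rewrite /= /Itv.num_sem /= num_real /= in_itv /= (ltW t0).
pose p : {i01 R} := Itv.mk t01.
have in0 (x : R) : 0 < x -> (x : convex_lmodType R^o) \in (`]0, +oo[%classic : set R).
  by move=> x0; rewrite inE /= in_itv /= x0.
have := cpsi p _ _ (in0 _ s0) (in0 _ ltr01).
have -> : conv p (s : convex_lmodType R^o) (1 : R) = 1 + t * (s - 1).
  by rewrite [LHS](_ : _ = t * s + (1 - t) * 1) //; ring.
rewrite convRE /= /unstable.onem; lra.
Qed.

(** If the graph rose above its tangent at [s], concavity would keep the same excess slope on every
    shorter chord from 1 towards [s], against differentiability at 1. *)
Lemma concave_pos_tangent (s : R) : derivable psi 1 1 -> concave_pos psi ->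
  0 < s -> psi s - psi 1 <= derive1 psi 1 * (s - 1).
Proof.
move=> dpsi cpsi s0; rewrite derive1E leNgt; apply/negP => gap.
have s1 : s - 1 != 0.
  by apply: contraTneq gap => /subr0_eq ->; rewrite !subrr mulr0 ltxx.
set d := 'D_1 psi 1 in gap.
have e0 : 0 < (psi s - psi 1 - d * (s - 1)) / `|s - 1|.
  by rewrite divr_gt0 ?subr_gt0 ?normr_gt0.
have /cvgrPdist_lt /(_ _ e0) : h^-1 *: ((psi \o shift 1) (h *: 1) - psi 1)
  @[h --> 0^'] --> d := dpsi.
rewrite /dnbhs /= => -[r /= r0] Hr.
(* The cap 1 keeps the point between 1 and [s]; [r / 2] makes its distance to 1 strictly less than
   [r]. *)
pose t := Num.min 1 (r / 2 / `|s - 1|).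
have t0 : 0 < t by rewrite lt_min ltr01 !divr_gt0 ?normr_gt0.
have t1 : t <= 1 by rewrite ge_min lexx.
have tr : `|t * (s - 1)| < r.
  rewrite normrM gtr0_norm //.
  rewrite (@le_lt_trans _ _ (r / 2)) ?ltr_pdivrMr ?ltr_pMr ?ltr1n //.
  by rewrite -ler_pdivlMr ?normr_gt0 // ge_min lexx orbT.
have h0 : t * (s - 1) != 0 by rewrite mulf_neq0 // gt_eqF.
have := Hr (t * (s - 1)).
rewrite /ball_ /= sub0r normrN => /(_ tr h0).
rewrite ltr_pdivlMr ?normr_gt0 // -normrM ltNge => /negP; apply.
rewrite -normrN ler_normr; apply/orP; left.
rewrite /GRing.scale /= mulr1.
have := concave_pos_ge cpsi s0 (t := t); rewrite t0 t1 => /(_ isT).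
move=> H.
have -> : - ((d - (t * (s - 1))^-1 * (psi (t * (s - 1) + 1) - psi 1)) * (s - 1))
  = t^-1 * (psi (t * (s - 1) + 1) - psi 1) - d * (s - 1).
  by field; rewrite s1 gt_eqF.
by rewrite lerD2r ler_pdivlMl // [t * _ + 1]addrC.
Qed.

Lemma C1_pos_lower_bound (a b : R) : C1_pos psi -> 0 < a ->
  exists K : R, forall s, a <= s <= b -> K <= psi s.
Proof.
move=> psiC1 a0; have [ab|ba] := leP a b; last first.
  exists 0 => s /andP[as_ sb].
  by move: (lt_le_trans ba (le_trans as_ sb)); rewrite ltxx.
have : {within `[a, b], continuous psi}.
  apply: derivable_within_continuous => x; rewrite in_itv /= => /andP[ax _].
  by case: (psiC1 x (lt_le_trans a0 ax)).
move=> /(EVT_min ab)[c _ cmin]; exists (psi c) => s sab.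
by apply: cmin; rewrite in_itv.
Qed.

End Psi.

(** * Vanishing of the Cheeger constant *)

Lemma ler_sum_fset (R : realDomainType) (T : choiceType) (A B : {fset T})
    (F : T -> R) : (A `<=` B)%fset -> (forall x, 0 <= F x) ->
  \sum_(x <- A) F x <= \sum_(x <- B) F x.
Proof.
move=> AB F0; pose F' x := if x \in A then F x else 0.
rewrite (eq_big_seq F') => [|x xA]; last by rewrite /F' xA.
rewrite (@big_fset_incl _ _ _ _ A B) //; last by rewrite /F' => x _ /negbTE ->.
by apply: ler_sum => x _; rewrite /F'; case: ifP.
Qed.

(** * Dirichlet problems on finite pieces of the graph *)

Section Graph.
Context {R : realType} {V : choiceType} (G : weighted_graph R V).
Implicit Types (f g F : V -> R) (x y : V) (A B S : {fset V}).

Definition nb x : {fset V} := fset_set (nbr G x).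

(** Off the edges [weight] is arbitrary. Cutting it to 0 there lets sums over neighbours be taken
    over any larger finite set. *)
Definition kern x y : R := if adj G x y then weight G x y else 0.

Definition closed_nb A : {fset V} := (A `|` \bigcup_(x <- A) nb x)%fset.

Lemma in_nb x y : (y \in nb x) = adj G x y.
Proof.
rewrite in_fset_set; last exact: adj_finite.
by apply/idP/idP => [/set_mem|H] //; apply/mem_set.
Qed.

Lemma kern_ge0 x y : 0 <= kern x y.
Proof. by rewrite /kern; case: ifP => // /weight_gt0/ltW. Qed.

Lemma kernC x y : kern x y = kern y x.
Proof. by rewrite /kern adj_sym; case: ifP => // /weight_sym. Qed.

Lemma kern_sum x B F : (nb x `<=` B)%fset ->
  \sum_(y <- nb x) kern x y * F y = \sum_(y <- B) kern x y * F y.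
Proof.
move=> xB; apply: big_fset_incl => // y _; rewrite in_nb /kern => /negbTE ->.
by rewrite mul0r.
Qed.

Lemma nbr_sum x F :
  \sum_(y \in nbr G x) weight G x y * F y = \sum_(y <- nb x) kern x y * F y.
Proof.
rewrite fsbig_finite; last exact: adj_finite.
by apply: eq_big_seq => y; rewrite [_ \in _]in_nb /kern => ->.
Qed.

Lemma degE x : deg G x = \sum_(y <- nb x) kern x y.
Proof.
transitivity (\sum_(y \in nbr G x) weight G x y * 1).
  by apply: eq_fsbigr => y _; rewrite mulr1.
by rewrite nbr_sum; apply: eq_bigr => y _; rewrite mulr1.
Qed.

Lemma laplacianE f x :
  laplacian G f x = (mu G x)^-1 * \sum_(y <- nb x) kern x y * (f y - f x).
Proof. by rewrite /laplacian (nbr_sum x (fun y => f y - f x)). Qed.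

Lemma kern_sum_le_deg x B : \sum_(y <- B) kern x y <= deg G x.
Proof.
rewrite degE; apply: (@le_trans _ _ (\sum_(y <- (nb x `|` B)%fset) kern x y)).
  apply: ler_sum_fset => [|y]; [exact: fsubsetUr | exact: kern_ge0].
rewrite -(@big_fset_incl _ _ _ _ (nb x)) ?fsubsetUl // => y _.
by rewrite in_nb /kern => /negbTE ->.
Qed.

Lemma subset_closed_nb A : (A `<=` closed_nb A)%fset.
Proof. exact: fsubsetUl. Qed.

Lemma nb_closed_nb A x : x \in A -> (nb x `<=` closed_nb A)%fset.
Proof.
move=> xA; apply/fsubsetP => y yx; rewrite in_fsetU; apply/orP; right.
by apply/bigfcupP; exists x; rewrite ?xA.
Qed.

(** Amounts to [h <= cheeger G], cleared of denominators so that the empty set may be included. *)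
Definition isoperimetric (h : R) := forall S,
  h * \sum_(x <- S) mu G x
    <= \sum_(x <- S) \sum_(y <- nb x | y \notin S) kern x y.

(** The finite network is [closed_nb A] with interior [A]; it contains every edge that starts in
    [A], so it sees both the full Laplacian on [A] and the full boundary of each subset of [A]. *)
Lemma dirichlet_eigenfunction (h D : R) A : 0 < h -> 0 < D ->
    (forall x, deg G x <= D * mu G x) -> isoperimetric h ->
  exists f, (forall x, 1 <= f x) /\
    (forall x, x \in A -> laplacian G f x = - (h ^+ 2 / (16 * D)) * f x).
Proof.
move=> h0 D0 degD iso; set l := h ^+ 2 / (16 * D).
pose B := closed_nb A.
pose k (x y : B) := kern (val x) (val y); pose m (x : B) := mu G (val x).
pose O : {set B} := [set x | val x \in A]%SET.
have k0 (x y : B) : 0 <= k x y by exact: kern_ge0.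
have kC (x y : B) : k x y = k y x by exact: kernC.
have m0 (x : B) : 0 < m x by exact: mu_gt0.
have kD (x : B) : \sum_y k x y <= D * m x.
  apply: le_trans (degD _); rewrite -(big_seq_fsetE _ _ predT (kern (val x))) /=.
  exact: kern_sum_le_deg.
have kiso (S : {set B}) : S \subset O ->
    h * \sum_(x in S) m x <= \sum_(x in S) \sum_(y in ~: S) k x y.
  move=> SO; pose S' : {fset V} := [fset val x | x in S]%fset.
  have inS' (x : B) : (val x \in S') = (x \in S).
    by rewrite mem_imfset //; exact: val_inj.
  have sumS (F : V -> R) : \sum_(x <- S') F x = \sum_(x in S) F (val x).
    rewrite big_imfset /=; last by move=> x y _ _ /val_inj.
    by rewrite big_enum.
  have := iso S'; rewrite !sumS => /le_trans; apply.
  rewrite ler_sum // => x xS; rewrite le_eqVlt; apply/orP; left; apply/eqP.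
  have xA : val x \in A by have := fintype.subsetP SO x xS; rewrite inE.
  transitivity (\sum_(y <- nb (val x))
      kern (val x) y * (if y \notin S' then 1 else 0)).
    rewrite big_mkcond; apply: eq_bigr => y _.
    by case: ifP; rewrite ?mulr1 ?mulr0.
  rewrite (kern_sum _ (nb_closed_nb xA)) big_seq_fsetE /= [RHS]big_mkcond /=.
  apply: eq_bigr => y _; rewrite finset.in_setC inS'.
  by case: ifP; rewrite ?mulr1 ?mulr0.
have l0 : 0 <= l by rewrite divr_ge0 ?sqr_ge0 // mulr_ge0 // ltW.
(* Cheeger's inequality and Green's formula give coercivity with constant [h ^+ 2 / (8 * D)]; [l] is
   half of it. *)
have ll1 : l < h ^+ 2 / (8 * D).
  rewrite /l ltr_pM2l ?exprn_gt0 // ltf_pV2 ?posrE ?mulr_gt0 //.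
  by rewrite ltr_pM2r // ltr_nat.
have [|f [f1 fE]] := dirichlet_positive_solution k0 m0 (O := O) l0 ll1.
  move=> g gO; have := cheeger_ineq k0 kC h0 D0 kiso kD gO.
  rewrite (dirichlet_form kC) mulrA => H.
  rewrite mulrAC ler_pdivrMr ?mulr_gt0 //.
  by rewrite (le_trans H) // le_eqVlt; apply/orP; left; apply/eqP; ring.
(* The value 1 outside the network preserves [f >= 1] and is not seen by the Laplacian on [A]. *)
pose f' x := if insub x is Some z then f z else 1.
have f'E (x : B) : f' (val x) = f x by rewrite /f' valK.
exists f'; split=> [x|x xA]; first by rewrite /f'; case: insub.
have xB : x \in B by exact: (fsubsetP (subset_closed_nb A)).
pose z : B := [` xB]%fset.
rewrite laplacianE (kern_sum (fun y => f' y - f' x) (nb_closed_nb xA)).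
rewrite big_seq_fsetE /=.
have := fE z; rewrite inE /= => /(_ xA).
under eq_bigr do rewrite -!f'E.
rewrite -f'E /= => ->; rewrite /m /= -mulrA mulrCA mulKf //.
by rewrite gt_eqF // mu_gt0.
Qed.

End Graph.

(** * Consequences of the curvature condition for a local eigenfunction *)

Section CurvatureDimension.
Context {R : realType} {V : choiceType} (G : weighted_graph R V).
Context (psi : R -> R) (f : V -> R) (l : R).
Hypothesis f_gt0 : forall x, 0 < f x.
Implicit Types x y : V.

Let u x := - laplacian_psi G psi f x.
(** A condition at one vertex, since the equation is available only inside a ball. *)
Let eigen x := laplacian G f x = - l * f x.

Lemma neg_laplacian_psiE x :
  u x = (mu G x)^-1 * \sum_(y <- nb G x) kern G x y * (psi 1 - psi (f y / f x)).
Proof.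
rewrite /u /laplacian_psi laplacianE -mulrN divff ?gt_eqF // -sumrN.
by congr (_ * _); apply: eq_bigr => y _; rewrite -mulrN opprB.
Qed.

(** The eigenvalue equation divided by [f x]. It yields the lower bound on [u], the total mass of
    the coefficients in the growth estimate, and the bound on each ratio. *)
Lemma eigen_sum_ratio x : eigen x ->
  (mu G x)^-1 * \sum_(y <- nb G x) kern G x y * (f y / f x)
    = deg G x / mu G x - l.
Proof.
rewrite /eigen laplacianE degE => ex.
have -> : l = - ((mu G x)^-1 * (\sum_(y <- nb G x) kern G x y * (f y - f x))) / f x.
  by rewrite ex !mulNr opprK mulfK // gt_eqF.
rewrite mulNr opprK -mulrA [_ / mu G x]mulrC -mulrDr mulr_suml -big_split /=.
congr (_ * _); apply: eq_bigr => y _; field.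
by rewrite gt_eqF.
Qed.

(** The tangent bound [psi 1 - psi s >= psi'(1) (1 - s)] at the ratios, summed with the edge
    weights. *)
Lemma neg_laplacian_psi_ge x : derivable psi 1 1 -> concave_pos psi ->
  eigen x -> derive1 psi 1 * l <= u x.
Proof.
move=> dpsi cpsi ex; set d := derive1 psi 1.
have -> : d * l = (mu G x)^-1 *
    \sum_(y <- nb G x) kern G x y * (d * (1 - f y / f x)).
  rewrite -[l](subKr (deg G x / mu G x)) -eigen_sum_ratio // degE.
  rewrite [_ / _]mulrC -mulrBr -sumrB mulrCA mulr_sumr.
  by congr (_ * _); apply: eq_bigr => y _; ring.
rewrite neg_laplacian_psiE ler_wpM2l ?invr_ge0 ?(ltW (mu_gt0 _ _)) //.
apply: ler_sum => y _; rewrite ler_wpM2l ?kern_ge0 //.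
have := concave_pos_tangent dpsi cpsi (divr_gt0 (f_gt0 y) (f_gt0 x)).
rewrite -/d; lra.
Qed.

Lemma CDpsi_eigen (n : R) x : CDpsi G psi n 0 -> eigen x ->
    (forall y, y \in nb G x -> eigen y) ->
  2 / n * u x ^+ 2 <=
    (mu G x)^-1 * \sum_(y <- nb G x) kern G x y * (f y / f x) * (u y - u x).
Proof.
move=> CD ex enb; have := CD f f_gt0 x; rewrite mul0r addr0.
have fn0 y : f y != 0 by rewrite gt_eqF.
have Ey y : eigen y -> laplacian G f y / f y = - l.
  by move=> ->; rewrite mulfK.
have -> : laplacian_psi G psi f x = - u x by rewrite opprK.
rewrite sqrrN /Gamma2_psi.
have -> : Omega_psi G psi f x = 0.
  rewrite /Omega_psi laplacianE big1_seq ?mulr0 // => y /= ynb.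
  rewrite !Ey //; last exact: enb.
  by rewrite subrr !mulr0 subrr mulr0.
have -> : laplacian_psi G psi f x = - u x by rewrite opprK.
have -> : laplacian G (fun y => f y * laplacian_psi G psi f y) x / f x =
    - ((mu G x)^-1 * \sum_(y <- nb G x) kern G x y * (f y / f x) * (u y - u x))
    - u x * (laplacian G f x / f x).
  (* Product rule: each increment of [f u] splits as [f y (u y - u x) + u x (f y - f x)]. The second
     part cancels the middle term of [Gamma2_psi]. *)
  rewrite !laplacianE.
  transitivity ((mu G x)^-1 *
    (- (\sum_(y <- nb G x) kern G x y * (f y / f x) * (u y - u x))
     - (u x / f x) * \sum_(y <- nb G x) kern G x y * (f y - f x))); last by ring.
  rewrite -[LHS]mulrA; congr (_ * _).
  rewrite mulr_suml mulr_sumr -sumrN -sumrB; apply: eq_bigr => y _.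
  by rewrite /u; field.
rewrite add0r mulrAC Ey // ler_pdivlMr // => H.
by rewrite (_ : 2 / n * u x ^+ 2 = n^-1 * u x ^+ 2 * 2) ?(le_trans H) //; lra.
Qed.

(** Averaging: were all increments below [e], the weighted sum in [CDpsi_eigen] would stay below
    [e * D], and [e] is chosen so that [e * D = 2 / n * c ^+ 2 <= 2 / n * u x ^+ 2]. *)
Lemma neg_laplacian_psi_growth (n D : R) x : 0 < n -> 0 < l -> 0 < D ->
    0 < derive1 psi 1 ->
    derivable psi 1 1 -> concave_pos psi -> CDpsi G psi n 0 ->
    (forall y, deg G y <= D * mu G y) ->
    eigen x -> (forall y, y \in nb G x -> eigen y) ->
  exists2 y, y \in nb G x &
    u x + 2 * (derive1 psi 1 * l) ^+ 2 / (n * D) <= u y.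
Proof.
move=> n0 l0 D0 d0 dpsi cpsi CD degD ex enb; set c := derive1 psi 1 * l.
set e := 2 * c ^+ 2 / (n * D).
have c0 : 0 < c by exact: mulr_gt0.
have e0 : 0 < e by rewrite divr_gt0 ?mulr_gt0 ?exprn_gt0.
apply: contrapT => small.
have {}small y : y \in nb G x -> u y - u x <= e.
  move=> ynb; rewrite leNgt; apply/negP => uy; apply: small; exists y => //.
  by rewrite -lerBrDl ltW.
have ux := neg_laplacian_psi_ge dpsi cpsi ex.
have := CDpsi_eigen CD ex enb; apply/negP; rewrite -ltNge.
have mu0 := mu_gt0 G x.
apply: (@le_lt_trans _ _ (e * (deg G x / mu G x - l))).
  rewrite -eigen_sum_ratio // mulrCA ler_wpM2l ?invr_ge0 ?(ltW mu0) //.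
  rewrite mulr_sumr.
  rewrite [leLHS]big_seq [leRHS]big_seq ler_sum // => y ynb.
  rewrite mulrC ler_wpM2r ?small //.
  by rewrite mulr_ge0 ?kern_ge0 // divr_ge0 // ltW.
apply: (@lt_le_trans _ _ (e * D)).
  (* The contradiction is strict because the coefficients sum to [deg / mu - l] with [l > 0]. *)
  rewrite ltr_pM2l // ltrBlDr (le_lt_trans (y := D)) ?ltrDl //.
  by rewrite ler_pdivrMr.
rewrite (_ : e * D = 2 / n * c ^+ 2); last by rewrite /e; field; rewrite !gt_eqF.
by rewrite ler_wpM2l ?divr_ge0 ?(ltW n0) // lerXn2r ?nnegrE ?(ltW c0) //
  (le_trans (ltW c0)).
Qed.

(** A Harnack inequality across one edge: a single term of the nonnegative sum in [eigen_sum_ratio]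
    is at most the whole, and its weight is at least [c]. *)
Lemma eigen_ratio_le (D M c : R) x y : 0 <= l -> 0 < c ->
    deg G x <= D * mu G x -> mu G x <= M -> 0 <= D -> c <= weight G x y ->
    eigen x -> y \in nb G x ->
  f y / f x <= D * M / c.
Proof.
move=> l0 c0 degD muM D0 cw ex ynb.
have mu0 := mu_gt0 G x.
have kc : c <= kern G x y by move: ynb; rewrite in_nb /kern => ->.
rewrite ler_pdivlMr //.
have r0 z : 0 <= f z / f x by rewrite divr_ge0 // ltW.
apply: (@le_trans _ _ (\sum_(z <- nb G x) kern G x z * (f z / f x))).
  rewrite (big_fsetD1 y) //=.
  apply: (@le_trans _ _ (kern G x y * (f y / f x))).
    by rewrite mulrC ler_wpM2r.
  by rewrite lerDl sumr_ge0 // => z _; rewrite mulr_ge0 ?kern_ge0.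
have := eigen_sum_ratio ex => /(congr1 (fun a => mu G x * a)).
rewrite mulrA divff ?gt_eqF // mul1r => ->.
rewrite mulrBr mulrCA divff ?gt_eqF // mulr1.
apply: (@le_trans _ _ (D * mu G x)); last by rewrite ler_wpM2l.
by rewrite (le_trans _ degD) // gerBl mulr_ge0 // ltW.
Qed.

(** Since [psi] may tend to minus infinity at 0, the ratios must also stay away from 0: the equation
    at the neighbour [y] bounds [f x / f y] from above. *)
Lemma neg_laplacian_psi_le (D M c K : R) x : 0 <= l -> 0 < c -> 0 <= D ->
    (forall y, deg G y <= D * mu G y) -> (forall y, mu G y <= M) ->
    (forall y z, adj G y z -> c <= weight G y z) ->
    0 <= K ->
    (forall s, (D * M / c + 1)^-1 <= s <= D * M / c + 1 -> psi 1 - psi s <= K) ->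
    eigen x -> (forall y, y \in nb G x -> eigen y) ->
  u x <= D * K.
Proof.
move=> l0 c0 D0 degD muM cw K0 psiK ex enb; have mu0 := mu_gt0 G x.
rewrite neg_laplacian_psiE mulrC ler_pdivrMr // mulrAC.
apply: (@le_trans _ _ (deg G x * K)); last by rewrite ler_wpM2r.
rewrite degE mulr_suml [leLHS]big_seq [leRHS]big_seq ler_sum // => y ynb.
rewrite ler_wpM2l ?kern_ge0 // psiK //; set C := D * M / c.
have axy : adj G x y by rewrite -in_nb.
have ayx : adj G y x by rewrite adj_sym.
have C1 z w : adj G z w -> eigen z -> f w / f z <= C + 1.
  move=> azw ez; apply: le_trans (_ : C <= C + 1); last by rewrite lerDl.
  by apply: eigen_ratio_le; rewrite ?cw ?in_nb.
have C0 : 0 < C + 1 by rewrite (lt_le_trans _ (C1 _ _ axy ex)) // divr_gt0.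
rewrite C1 // andbT -[f y / f x]invrK lef_pV2 ?posrE ?invr_gt0 ?divr_gt0 //.
by rewrite invf_div C1 //; exact: enb.
Qed.

End CurvatureDimension.

Lemma ereal_sup_lty_bound (R : realType) (T : Type) (F : T -> R) :
  (ereal_sup [set (F x)%:E | x in setT] < +oo)%E ->
  exists2 r : R, 0 < r & forall x, F x <= r.
Proof.
have ub x : ((F x)%:E <= ereal_sup [set (F x)%:E | x in setT])%E.
  by apply: ereal_sup_ubound; exists x.
case: ereal_sup ub => [r ub _| |ub _] //.
  exists (Num.max 1 r) => [|x]; first by rewrite lt_max ltr01.
  by rewrite le_max -!lee_fin ub orbT.
by exists 1 => // x; have := ub x; rewrite leeNy_eq.
Qed.

(** The value [+oo] does occur: [w_min] is an infimum over the empty set when there are no edges. *)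
Lemma ereal_gt0_real (R : realType) (a : \bar R) : (0 < a)%E ->
  exists2 r : R, 0 < r & (r%:E <= a)%E.
Proof.
case: a => [r r0| _|//]; first by exists r; rewrite -?lte_fin.
by exists 1; rewrite ?leey.
Qed.

(** * The contradiction with a positive Cheeger constant *)

Section Cheeger.
Context {R : realType} {V : choiceType} (G : weighted_graph R V).
Implicit Types (x y : V) (S : {fset V}).

Lemma volumeE S : volume G [set` S] = \sum_(x <- S) mu G x.
Proof. by rewrite /volume fsbig_finite // set_fsetK. Qed.

Lemma boundary_weightE S : boundary_weight G [set` S] =
  \sum_(x <- S) \sum_(y <- nb G x | y \notin S) kern G x y.
Proof.
rewrite /boundary_weight fsbig_finite // set_fsetK; apply: eq_bigr => x _.
rewrite fsbig_finite; last by apply: finite_setD; exact: adj_finite.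
rewrite fset_setD //; last exact: adj_finite.
rewrite set_fsetK -[RHS]big_filter.
rewrite big_seq [RHS]big_seq.
transitivity (\sum_(y <- (nb G x `\` S)%fset | y \in (nb G x `\` S)%fset) kern G x y).
  by apply: eq_bigr => y; rewrite in_fsetD in_nb /kern => /andP[_ ->].
rewrite -!big_seq; apply: perm_big; apply: uniq_perm.
- exact: fset_uniq.
- by rewrite filter_uniq.
- by move=> y; rewrite mem_filter in_fsetD.
Qed.

Lemma cheeger_ge0 : (0 <= cheeger G)%E.
Proof.
apply: le_ereal_inf_tmp => _ [A [fO _] <-]; rewrite lee_fin.
rewrite -(fset_setK fO) boundary_weightE volumeE divr_ge0 //; last first.
  by apply: sumr_ge0 => x _; rewrite ltW // mu_gt0.
by apply: sumr_ge0 => ? _; apply: sumr_ge0 => ? _; exact: kern_ge0.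
Qed.

Lemma volume_gt0 S : S != fset0 -> 0 < \sum_(x <- S) mu G x.
Proof.
move=> /fset0Pn[x xS]; rewrite (big_fsetD1 x) //= ltr_pwDl ?mu_gt0 //.
by apply: sumr_ge0 => y _; rewrite ltW // mu_gt0.
Qed.

Lemma cheeger_eq0 : (forall h : R, 0 < h -> ~ isoperimetric G h) ->
  cheeger G = 0%E.
Proof.
move=> noiso; apply/eqP; rewrite eq_le cheeger_ge0 andbT leNgt.
apply/negP => /ereal_gt0_real[h h0 hG]; apply: (noiso h h0) => S.
have [->|S0] := eqVneq S fset0; first by rewrite !big_seq_fset0 mulr0.
rewrite -ler_pdivlMr ?volume_gt0 // -lee_fin (le_trans hG) //.
apply: ereal_inf_lbound; exists [set` S]; last first.
  by rewrite boundary_weightE volumeE.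
by split => //; case/fset0Pn: S0 => x xS; exists x.
Qed.

(* The function [u = - Delta^psi f] built on a Dirichlet eigenfunction [f] gains
   a fixed amount at a suitable neighbour of every vertex, yet it is bounded. *)
Lemma CDpsi_no_isoperimetric (psi : R -> R) (n h : R) :
    (D_mu G < +oo)%E -> (mu_max G < +oo)%E -> (0 < w_min G)%E ->
    C1_pos psi -> concave_pos psi -> 0 < derive1 psi 1 ->
    0 < n -> CDpsi G psi n 0 -> 0 < h -> ~ isoperimetric G h.
Proof.
move=> /ereal_sup_lty_bound[D D0 degD] /ereal_sup_lty_bound[M M0 muM].
move=> /ereal_gt0_real[c c0 cw] psiC1 cpsi d0 n0 CD h0 iso.
have dpsi : derivable psi 1 1 by case: (psiC1 1 ltr01).
have {}degD x : deg G x <= D * mu G x by rewrite -ler_pdivrMr ?mu_gt0.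
have {}cw x y : adj G x y -> c <= weight G x y.
  move=> axy; rewrite -lee_fin (le_trans cw) //.
  by apply: ereal_inf_lbound; exists (x, y).
have C0 : 0 < D * M / c + 1 by apply: addr_gt0 => //; apply: divr_gt0 => //; exact: mulr_gt0.
have [K0 psiK0] := C1_pos_lower_bound (D * M / c + 1) psiC1
  (etrans (invr_gt0 _) C0).
pose K := Num.max 0 (psi 1 - K0).
have K_ge0 : 0 <= K by rewrite le_max lexx.
have psiK s : (D * M / c + 1)^-1 <= s <= D * M / c + 1 -> psi 1 - psi s <= K.
  by move=> /psiK0 Ks; rewrite le_max lerD2l lerN2 Ks orbT.
pose l := h ^+ 2 / (16 * D).
have l0 : 0 < l by rewrite divr_gt0 ?exprn_gt0 ?mulr_gt0.
pose d := 2 * (derive1 psi 1 * l) ^+ 2 / (n * D).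
have dgt0 : 0 < d.
  by rewrite divr_gt0 ?(mulr_gt0 n0) // mulr_gt0 // exprn_gt0 // mulr_gt0.
(* After [N] gains of [d], the value of [u] exceeds its upper bound [D * K]. *)
pose N := Num.bound (D * K / d).
case: (vertex_nonempty G) => o _.
pose ball k : {fset V} := iter k (closed_nb G) [fset o]%fset.
have ball_sub j k : (j <= k)%N -> (ball j `<=` ball k)%fset.
  move=> /subnK <-; elim: (k - j)%N => [|i IH] //=.
  by apply: fsubset_trans IH (subset_closed_nb _ _).
(* Radius [N.+1], because at a vertex of [ball N] the equation is also needed at its neighbours. *)
have [f [f1 fE]] := dirichlet_eigenfunction (ball N.+1) h0 D0 degD iso.
have f0 x : 0 < f x by apply: lt_le_trans (f1 x).
have nbE k x : (k <= N)%N -> x \in ball k ->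
    laplacian G f x = - l * f x /\
    (forall y, y \in nb G x -> y \in ball k.+1 /\ laplacian G f y = - l * f y).
  move=> kN xk; split=> [|y ynb].
    by apply/fE/(fsubsetP (ball_sub _ _ (leqW kN))).
  have yk : y \in ball k.+1 by apply: (fsubsetP (nb_closed_nb _ xk)).
  by split=> //; apply/fE/(fsubsetP (ball_sub k.+1 N.+1 kN)).
have grow k : (k <= N)%N ->
    exists2 x, x \in ball k & k%:R * d <= - laplacian_psi G psi f x.
  elim: k => [_|k IH kN].
    exists o; first by rewrite inE.
    have [|eo _] := nbE 0%N o isT; first by rewrite inE.
    rewrite mul0r (le_trans _ (neg_laplacian_psi_ge f0 dpsi cpsi eo)) //.
    by rewrite mulr_ge0 // ltW.
  have [x xk ux] := IH (ltnW kN); have [ex enb] := nbE k x (ltnW kN) xk.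
  have [y ynb uy] := neg_laplacian_psi_growth f0 n0 l0 D0 d0 dpsi cpsi CD degD ex
    (fun y ynb => (enb y ynb).2).
  exists y; first exact: (enb y ynb).1.
  by rewrite (le_trans _ uy) // -natr1 mulrDl mul1r lerD2r.
have [x xN] := grow N (leqnn N); have [ex enb] := nbE N x (leqnn N) xN.
apply/negP; rewrite -ltNge.
apply: le_lt_trans (neg_laplacian_psi_le f0 (ltW l0) c0 (ltW D0) degD muM cw K_ge0
  psiK ex (fun y ynb => (enb y ynb).2)) _.
rewrite -ltr_pdivrMr //; apply: archi_boundP.
by apply: divr_ge0; [exact: mulr_ge0 (ltW D0) K_ge0 | exact: ltW].
Qed.

End Cheeger.

(** * Spectrum *)

Section SquareSummable.
Context {R : realType} {V : choiceType} (G : weighted_graph R V).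
Implicit Types (f g F : V -> R) (x y : V) (A S : {fset V}).

(** All [l^2] estimates below are bounds on finite sums in this form, which avoids arithmetic with
    infinite values. *)
Definition sums_le F (M : R) := forall A, \sum_(x <- A) mu G x * F x <= M.

(** As [fine] sends [+oo] to 0, this is the true sum only once some finite bound is known. *)
Definition mu_sum F : R := fine (\esum_(x in [set: V]) (mu G x * F x)%:E).

Lemma esum_leP (a : V -> R) (M : R) :
  (\esum_(x in [set: V]) (a x)%:E <= M%:E)%E <->
  (forall A, \sum_(x <- A) a x <= M).
Proof.
split=> [aM A|aM]; last first.
  apply: ge_ereal_sup => _ [B [fB _] <-].
  by rewrite fsbig_finite // sumEFin lee_fin.
rewrite -lee_fin (le_trans _ aM) //; apply: ereal_sup_ubound.
exists [set` A]; first by split.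
by rewrite fsbig_finite // set_fsetK sumEFin.
Qed.

Lemma sums_leW (a b : R) F F1 F2 (M1 M2 : R) : 0 <= a -> 0 <= b ->
    (forall x, F x <= a * F1 x + b * F2 x) ->
  sums_le F1 M1 -> sums_le F2 M2 -> sums_le F (a * M1 + b * M2).
Proof.
move=> a0 b0 FF F1M F2M A.
apply: le_trans (lerD (ler_wpM2l a0 (F1M A)) (ler_wpM2l b0 (F2M A))).
rewrite !mulr_sumr -big_split ler_sum // => x _ /=.
rewrite [leRHS](_ : _ = mu G x * (a * F1 x + b * F2 x)); last by ring.
by rewrite ler_wpM2l // ltW // mu_gt0.
Qed.

Lemma esum_mu_sum F M : (forall x, 0 <= F x) -> sums_le F M ->
  (\esum_(x in [set: V]) (mu G x * F x)%:E)%E = (mu_sum F)%:E.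
Proof.
move=> F0 /esum_leP FM; rewrite /mu_sum fineK // ge0_fin_numE.
  exact: le_lt_trans FM (ltry _).
by apply: esum_ge0 => x _; rewrite lee_fin mulr_ge0 // ltW // mu_gt0.
Qed.

Lemma sums_le_mu_sum F M : (forall x, 0 <= F x) -> sums_le F M ->
  sums_le F (mu_sum F).
Proof. by move=> F0 FM; apply/esum_leP; rewrite (esum_mu_sum F0 FM). Qed.

Lemma mu_sum_le F M : (forall x, 0 <= F x) -> sums_le F M -> mu_sum F <= M.
Proof.
by move=> F0 FM; rewrite -lee_fin -(esum_mu_sum F0 FM); exact/esum_leP.
Qed.

Lemma mu_sum_ge0 F : (forall x, 0 <= F x) -> 0 <= mu_sum F.
Proof.
move=> F0; apply: fine_ge0; apply: esum_ge0 => x _.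
by rewrite lee_fin mulr_ge0 // ltW // mu_gt0.
Qed.

Lemma mu_sum_fset F S : (forall x, x \notin S -> F x = 0) ->
  (forall x, 0 <= F x) -> mu_sum F = \sum_(x <- S) mu G x * F x.
Proof.
move=> FS F0; have mF0 x : 0 <= mu G x * F x by rewrite mulr_ge0 // ltW // mu_gt0.
have FM : sums_le F (\sum_(x <- S) mu G x * F x).
  move=> A; apply: (@le_trans _ _ (\sum_(x <- (S `|` A)%fset) mu G x * F x)).
    exact/ler_sum_fset/mF0/fsubsetUr.
  rewrite -(@big_fset_incl _ _ _ _ S) ?fsubsetUl // => x _ /FS ->.
  by rewrite mulr0.
apply/eqP; rewrite eq_le mu_sum_le //=; exact: (sums_le_mu_sum F0 FM).
Qed.

Lemma l2P f : l2 G f <-> exists M, sums_le (fun x => f x ^+ 2) M.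
Proof.
have -> : l2 G f = (\esum_(x in [set: V]) (mu G x * f x ^+ 2)%:E < +oo)%E.
  by rewrite /l2 /=; under eq_esum do rewrite real_normK ?num_real //.
split=> [|[M /esum_leP fM]]; last exact: le_lt_trans fM (ltry _).
set s := esum _ _ => soo; exists (fine s); apply/esum_leP.
rewrite fineK // ge0_fin_numE //; apply: esum_ge0 => x _.
by rewrite lee_fin mulr_ge0 ?sqr_ge0 // ltW // mu_gt0.
Qed.

(** A pointwise nonnegative product has no negative part to subtract; squares and the Dirichlet
    products of indicators are of this kind. *)
Lemma l2_innerE f g : (forall x, 0 <= f x * g x) ->
  l2_inner G f g = mu_sum (fun x => f x * g x).
Proof.
move=> fg0; rewrite /l2_inner /mu_sum.
have h0 x : 0 <= mu G x * f x * g x.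
  by rewrite -mulrA mulr_ge0 // ltW // mu_gt0.
rewrite [X in _ - fine X]esum1 => [|x _]; last first.
  by rewrite funenegE -EFinN -EFin_max max_r // oppr_le0.
rewrite subr0; congr fine; apply: eq_esum => x _.
by rewrite funeposE -EFin_max max_l // mulrA.
Qed.

Lemma l2_normE f : l2_norm G f = Num.sqrt (mu_sum (fun x => f x ^+ 2)).
Proof. by rewrite /l2_norm l2_innerE // => x; rewrite -expr2 sqr_ge0. Qed.

End SquareSummable.

(** * The lazy random walk and its contractivity *)

Section TransitionOperator.
Context {R : realType} {V : choiceType} (G : weighted_graph R V) (D : R).
Hypotheses (D_gt0 : 0 < D) (degD : forall x, deg G x <= D * mu G x).
Implicit Types (f g F : V -> R) (x y : V) (A S : {fset V}).

(** The Markov operator of the walk that jumps from [x] to [y] with probability [w_xy / (D mu x)]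
    and otherwise stays; [mu] is reversible for it. *)
Definition transition f x : R := f x + D^-1 * laplacian G f x.

Lemma neg_laplacian_transition f x : neg_laplacian G f x = D * (f x - transition f x).
Proof.
by rewrite /neg_laplacian /transition; field; rewrite gt_eqF.
Qed.

Lemma transition_lin (a b c : R) f g x :
  transition (fun y => a * f y + b * g y + c) x = a * transition f x + b * transition g x + c.
Proof.
rewrite /transition !laplacianE.
have -> : \sum_(y <- nb G x) kern G x y *
    (a * f y + b * g y + c - (a * f x + b * g x + c)) =
  a * \sum_(y <- nb G x) kern G x y * (f y - f x)
  + b * \sum_(y <- nb G x) kern G x y * (g y - g x).
  by rewrite !mulr_sumr -big_split; apply: eq_bigr => y _ /=; ring.
ring.
Qed.

Lemma mu_transition f x : mu G x * transition f x =
  (mu G x - D^-1 * deg G x) * f x + D^-1 * \sum_(y <- nb G x) kern G x y * f y.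
Proof.
rewrite /transition laplacianE degE.
have -> : \sum_(y <- nb G x) kern G x y * (f y - f x) =
  \sum_(y <- nb G x) kern G x y * f y - (\sum_(y <- nb G x) kern G x y) * f x.
  by rewrite mulr_suml -sumrB; apply: eq_bigr => y _; ring.
by field; rewrite !gt_eqF ?mu_gt0.
Qed.

Lemma stay_ge0 x : 0 <= mu G x - D^-1 * deg G x.
Proof. by rewrite subr_ge0 ler_pdivrMl. Qed.

Lemma transition_ge0 F x : (forall y, 0 <= F y) -> 0 <= transition F x.
Proof.
move=> F0; rewrite -(pmulr_rge0 _ (mu_gt0 G x)) mu_transition.
rewrite addr_ge0 ?(mulr_ge0 (stay_ge0 _)) // mulr_ge0 ?invr_ge0 ?(ltW D_gt0) //.
by apply: sumr_ge0 => y _; rewrite mulr_ge0 ?kern_ge0.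
Qed.

(** Jensen's inequality, as nonnegativity of the variance of [f] after one step from [x]. *)
Lemma transition_sqr_le f x : transition f x ^+ 2 <= transition (fun y => f y ^+ 2) x.
Proof.
set m := transition f x.
have := @transition_ge0 (fun y => (f y - m) ^+ 2) x (fun y => sqr_ge0 _).
have -> : (fun y => (f y - m) ^+ 2) =
    (fun y => 1 * f y ^+ 2 + (- (2 * m)) * f y + m ^+ 2).
  by apply/funext => y; ring.
rewrite (transition_lin 1 (- (2 * m)) (m ^+ 2) (fun y => f y ^+ 2) f) -/m.
set Q := transition _ _; rewrite -[in X in _ -> X]subr_ge0.
by have -> : Q - m ^+ 2 = 1 * Q + - (2 * m) * m + m ^+ 2 by ring.
Qed.

(** The walk does not increase the mass of [F]: by symmetry of the kernel, what flows from [y] into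
    [A] is at most [deg y * F y / D], the mass that leaves [y]. With Jensen's inequality this makes
    the operator an [l^2] contraction. *)
Lemma sums_le_transition F M : (forall x, 0 <= F x) -> sums_le G F M ->
  sums_le G (transition F) M.
Proof.
move=> F0 FM A; apply: le_trans (FM (closed_nb G A)); set B := closed_nb G A.
have AB : (A `<=` B)%fset := subset_closed_nb G A.
under eq_bigr do rewrite mu_transition.
rewrite big_split /= -mulr_sumr.
have -> : \sum_(x <- A) \sum_(y <- nb G x) kern G x y * F y =
    \sum_(y <- B) (\sum_(x <- A) kern G x y) * F y.
  transitivity (\sum_(x <- A) \sum_(y <- B) kern G x y * F y).
    by apply: eq_big_seq => x xA; apply/kern_sum/nb_closed_nb.
  by rewrite exchange_big; apply: eq_bigr => y _; rewrite mulr_suml.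
apply: (@le_trans _ _ (\sum_(x <- B) (mu G x - D^-1 * deg G x) * F x
    + D^-1 * \sum_(y <- B) deg G y * F y)).
  apply: lerD.
    by apply: ler_sum_fset => // x; rewrite mulr_ge0 ?stay_ge0.
  rewrite ler_wpM2l ?invr_ge0 ?(ltW D_gt0) // ler_sum // => y _.
  rewrite ler_wpM2r //; under eq_bigr do rewrite kernC.
  exact: kern_sum_le_deg.
rewrite le_eqVlt; apply/orP; left; apply/eqP.
by rewrite mulr_sumr -big_split; apply: eq_bigr => x _ /=; ring.
Qed.

Lemma sums_le_transition_sqr f M : sums_le G (fun x => f x ^+ 2) M ->
  sums_le G (transition (fun x => f x ^+ 2)) M.
Proof. by apply: sums_le_transition => x; exact: sqr_ge0. Qed.

End TransitionOperator.

(** * Resolvents at negative parameters *)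

Section Resolvent.
Context {R : realType} {V : choiceType} (G : weighted_graph R V) (D : R).
Hypotheses (D_gt0 : 0 < D) (degD : forall x, deg G x <= D * mu G x).
Implicit Types (f g : V -> R) (x y : V) (A S : {fset V}).

Local Notation P := (transition G D).
Local Notation sq f := (fun x => f x ^+ 2).

Lemma sums_le_convex (r M M' : R) f g (h : V -> R) : 0 <= r <= 1 ->
    (forall x, h x = (1 - r) * g x + r * P f x) ->
    sums_le G (sq g) M -> sums_le G (sq f) M' ->
  sums_le G (sq h) ((1 - r) * M + r * M').
Proof.
move=> /andP[r0 r1] hE gM fM.
apply: (sums_leW _ r0 _ gM (sums_le_transition_sqr D_gt0 degD fM)).
  by rewrite subr_ge0.
move=> x; rewrite hE.
apply: (@le_trans _ _ ((1 - r) * g x ^+ 2 + r * P f x ^+ 2)); last first.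
  by rewrite lerD2l ler_wpM2l // transition_sqr_le.
rewrite -subr_ge0 [X in 0 <= X](_ : _ = r * (1 - r) * (g x - P f x) ^+ 2).
  by rewrite mulr_ge0 ?sqr_ge0 // mulr_ge0 // subr_ge0.
by ring.
Qed.

(** Convexity gives [N <= (1 - r) M + r N] for the square sum [N] of [f]; membership in [l2] makes
    [N] finite, so it can be cancelled. *)
Lemma sums_le_fixpoint (r M : R) f g : 0 <= r < 1 -> l2 G f ->
    (forall x, f x = (1 - r) * g x + r * P f x) ->
  sums_le G (sq g) M -> sums_le G (sq f) M.
Proof.
move=> /andP[r0 r1] /l2P[M' fM'] fE gM.
have f0 x : 0 <= f x ^+ 2 by exact: sqr_ge0.
have fN := sums_le_mu_sum f0 fM'.
have r01 : 0 <= r <= 1 by rewrite r0 ltW.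
have := mu_sum_le f0 (sums_le_convex r01 fE gM fN).
rewrite -lerBlDr -{1}[mu_sum G (sq f)]mul1r -mulrBl ler_pM2l ?subr_gt0 // => NM A.
exact: le_trans (fN A) NM.
Qed.

Lemma l2_subr f g : l2 G f -> l2 G g -> l2 G (fun x => f x - g x).
Proof.
move=> /l2P[M fM] /l2P[M' gM']; apply/l2P; exists (2 * M + 2 * M').
apply: (sums_leW _ _ _ fM gM') => // x /=.
rewrite -subr_ge0 [X in 0 <= X](_ : _ = (f x + g x) ^+ 2); last by ring.
exact: sqr_ge0.
Qed.

Lemma l2_neg_laplacian f M : sums_le G (sq f) M ->
  sums_le G (sq (neg_laplacian G f)) (2 * D ^+ 2 * M + 2 * D ^+ 2 * M).
Proof.
move=> fM; have D2 : 0 <= 2 * D ^+ 2 by rewrite mulr_ge0 ?sqr_ge0.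
apply: (sums_leW D2 D2 _ fM (sums_le_transition_sqr D_gt0 degD fM)) => x.
rewrite (neg_laplacian_transition G D_gt0).
apply: (@le_trans _ _ (2 * D ^+ 2 * f x ^+ 2 + 2 * D ^+ 2 * P f x ^+ 2)).
  rewrite -subr_ge0 [X in 0 <= X](_ : _ = (D * (f x + P f x)) ^+ 2); last by ring.
  exact: sqr_ge0.
by rewrite lerD2l ler_wpM2l // transition_sqr_le.
Qed.

(** A form of Fatou's lemma: finite sums pass to pointwise limits. *)
Lemma sums_le_lim (F : (V -> R)^nat) f M :
    (forall x, F k x @[k --> \oo] --> f x) ->
    (forall k, sums_le G (sq (F k)) M) -> sums_le G (sq f) M.
Proof.
move=> Ff FM A.
have cvgA : \sum_(x <- A) mu G x * F k x ^+ 2 @[k --> \oo] -->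
    \sum_(x <- A) mu G x * f x ^+ 2.
  apply: (cvg_big add_continuous) => x _; apply: cvgM; [exact: cvg_cst | apply: cvgM; exact: Ff].
rewrite -(cvg_lim _ cvgA) //; apply: limr_le; first by apply/cvg_ex; eexists; exact: cvgA.
by apply: nearW => k; exact: FM.
Qed.

Lemma transition_cvg (F : (V -> R)^nat) f x :
    (forall y, F k y @[k --> \oo] --> f y) ->
  P (F k) x @[k --> \oo] --> P f x.
Proof.
move=> Ff.
suff cvgL : laplacian G (F k) x @[k --> \oo] --> laplacian G f x.
  by apply: cvgD; [exact: Ff | apply: cvgM; [exact: cvg_cst |]].
rewrite laplacianE; under eq_fun do rewrite laplacianE.
apply: cvgM; first exact: cvg_cst.
by apply: (cvg_big add_continuous) => y _; apply: cvgM; [exact: cvg_cst | exact: cvgB].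
Qed.

(* Picard iteration for [f = (1 - r) g + r P f]: the increments decay
   geometrically at every vertex, and the square sums stay bounded by
   convexity. *)
Lemma fixpoint_exists (r : R) g : 0 <= r < 1 -> l2 G g ->
  exists2 f, l2 G f & forall x, f x = (1 - r) * g x + r * P f x.
Proof.
move=> /andP[r0 r1] /l2P[M gM].
have r01 : 0 <= r <= 1 by rewrite r0 ltW.
pose F := fix F k : V -> R :=
  if k is k'.+1 then fun x => (1 - r) * g x + r * P (F k') x else fun=> 0.
have M0 : 0 <= M by have := gM fset0; rewrite big_seq_fset0.
have FM k : sums_le G (sq (F k)) M.
  elim: k => [A|k IH] /=.
    by rewrite big1 // => x _; rewrite expr0n mulr0.
  have := sums_le_convex r01 (h := F k.+1) (fun=> erefl) gM IH.
  by rewrite -mulrDl subrK mul1r.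
pose d k x := F k.+1 x - F k x.
have dM k : sums_le G (sq (d k)) (r ^+ k.*2 * M).
  elim: k => [|k IH].
    rewrite mul1r /d /= => A.
    under eq_bigr do rewrite subr0.
    exact: (FM 1%N).
  have dE x : d k.+1 x = r * P (d k) x.
    rewrite {1}/d /= opprD addrACA subrr add0r -mulrBr; congr (_ * _).
    have := transition_lin G D 1 (-1) 0 (F k.+1) (F k) x.
    rewrite addr0 mul1r mulN1r => <-; congr (transition G D _ x).
    by apply/funext => y; rewrite /d; ring.
  have dk := sums_le_transition_sqr D_gt0 degD IH.
  have r2 : 0 <= r ^+ 2 by exact: sqr_ge0.
  have -> : r ^+ k.+1.*2 * M = r ^+ 2 * (r ^+ k.*2 * M) + 0 * (r ^+ k.*2 * M).
    by rewrite doubleS -addn2 exprD; ring.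
  apply: (sums_leW r2 (lexx 0) _ dk dk) => x.
  by rewrite mul0r addr0 dE exprMn ler_wpM2l // transition_sqr_le.
(* One vertex carries at most the whole square sum of the increment. *)
have dx k x : `|d k x| <= Num.sqrt (M / mu G x) * r ^+ k.
  have mu0 := mu_gt0 G x.
  have := dM k [fset x]%fset; rewrite big_seq_fset1 -ler_pdivlMl // => H.
  rewrite -sqrtr_sqr.
  rewrite [leRHS](_ : _ = Num.sqrt (M / mu G x * r ^+ k.*2)).
    rewrite ler_sqrt; last first.
      by rewrite mulr_ge0 ?exprn_ge0 // mulr_ge0 // invr_ge0 ltW.
    by rewrite (le_trans H) // le_eqVlt; apply/orP; left; apply/eqP; ring.
  rewrite [RHS]sqrtrM; last by rewrite mulr_ge0 // invr_ge0 ltW.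
  by rewrite -muln2 exprM sqrtr_sqr ger0_norm // exprn_ge0.
have cvgF x : cvgn (fun k => F k x).
  have -> : (fun k => F k x) = series (fun k => d k x).
    apply/funext => k; rewrite /series /= /d telescope_sumr //= ?subr0 //.
  apply: normed_cvg; apply: (@series_le_cvg _ _ (geometric (Num.sqrt (M / mu G x)) r)).
  - by move=> k; exact: normr_ge0.
  - by move=> k; rewrite /geometric /= mulr_ge0 ?sqrtr_ge0 // exprn_ge0.
  - by move=> k; exact: dx.
  - by apply: is_cvg_geometric_series; rewrite ger0_norm.
pose f x := limn (fun k => F k x).
have Ff x : F k x @[k --> \oo] --> f x by exact: cvgF.
exists f; first by apply/l2P; exists M; exact: sums_le_lim Ff FM.
move=> x.
have Ff1 : F k.+1 x @[k --> \oo] --> f x.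
  by rewrite (cvg_shiftS (fun k => F k x)); exact: Ff.
have Ff2 : F k.+1 x @[k --> \oo] --> (1 - r) * g x + r * P f x.
  by apply: cvgD; [exact: cvg_cst | apply: cvgM; [exact: cvg_cst | exact: transition_cvg]].
exact: (cvg_unique (@norm_hausdorff _ _) Ff1 Ff2).
Qed.

Lemma negative_resolvent (l : R) : l < 0 -> resolvent_set G l.
Proof.
move=> l0; pose a := - l; have a0 : 0 < a by rewrite oppr_gt0.
pose r := D / (D + a).
have Da : 0 < D + a by exact: addr_gt0.
have r01 : 0 <= r < 1.
  by rewrite divr_ge0 ?(ltW D_gt0) ?(ltW Da) //= ltr_pdivrMr // mul1r ltrDl.
(* As [-Delta = D (1 - P)], the resolvent equation reads [(D + a) f = g + D P f]; dividing by
   [D + a] gives the fixed-point form with data [g / a]. *)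
have eqE f g x : neg_laplacian G f x - l * f x = g x <->
    f x = (1 - r) * (g x / a) + r * P f x.
  rewrite (neg_laplacian_transition G D_gt0) /r.
  have Dan0 : D + a != 0 by rewrite gt_eqF.
  have an0 : a != 0 by rewrite gt_eqF.
  have -> : (1 - D / (D + a)) * (g x / a) + D / (D + a) * P f x
    = (g x + D * P f x) / (D + a) by field; rewrite Dan0 an0.
  have -> : l = - a by rewrite opprK.
  split=> [<-|->]; first by field.
  by field.
have sumsD g M : sums_le G (sq g) M -> sums_le G (fun x => (g x / a) ^+ 2) (M / a ^+ 2).
  move=> gM; have a2 : 0 <= (a ^+ 2)^-1 by rewrite invr_ge0 sqr_ge0.
  have := sums_leW a2 (lexx 0) (F := fun x => (g x / a) ^+ 2) _ gM gM.
  rewrite mul0r addr0 mulrC; apply => x.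
  by rewrite mul0r addr0 expr_div_n mulrC.
have bound f M : l2 G f ->
    sums_le G (fun x => (neg_laplacian G f x - l * f x) ^+ 2) M ->
    sums_le G (sq f) (M / a ^+ 2).
  move=> fl2 /sumsD TM; apply: (sums_le_fixpoint r01 fl2 _ TM) => x.
  exact: (proj1 (eqE f (fun y => neg_laplacian G f y - l * f y) x) erefl).
have Tl2 f : l2 G f -> l2 G (fun x => neg_laplacian G f x - l * f x).
  move=> /[dup] fl2 /l2P[M fM]; apply: l2_subr.
    by apply/l2P; eexists; exact: l2_neg_laplacian fM.
  apply/l2P; exists (l ^+ 2 * M + 0 * M).
  apply: (sums_leW (sqr_ge0 l) (lexx 0) _ fM fM) => x.
  by rewrite mul0r addr0 exprMn.
have T0 f : l2 G f -> l2_norm G f <=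
    a^-1 * l2_norm G (fun x => neg_laplacian G f x - l * f x).
  move=> fl2; rewrite !l2_normE; pose T x := neg_laplacian G f x - l * f x.
  have /l2P[M TM] := Tl2 f fl2.
  have T_ge0 x : 0 <= T x ^+ 2 by exact: sqr_ge0.
  have := bound f _ fl2 (sums_le_mu_sum T_ge0 TM) => fT.
  have N0 := mu_sum_ge0 G T_ge0.
  have -> : a^-1 = Num.sqrt (a ^+ 2)^-1.
    by rewrite -exprVn sqrtr_sqr ger0_norm // invr_ge0 ltW.
  rewrite mulrC -sqrtrM // ler_sqrt; last first.
    by rewrite mulr_ge0 // invr_ge0 sqr_ge0.
  by apply: mu_sum_le fT => x; exact: sqr_ge0.
split; last by exists a^-1.
split; first by move=> f; exact: Tl2.
- move=> f g /set_mem fl2 /set_mem gl2 /= fg; apply/funext => x.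
  have fgl2 := l2_subr fl2 gl2.
  have T0fg : sums_le G (fun x =>
      (neg_laplacian G (fun y => f y - g y) x - l * (f x - g x)) ^+ 2) 0.
    move=> A; rewrite big1 // => y _.
    have /= := congr1 (fun u => u y) fg; rewrite /neg_laplacian.
    have -> : laplacian G (fun y => f y - g y) y = laplacian G f y - laplacian G g y.
      rewrite !laplacianE -mulrBr -sumrB; congr (_ * _).
      by apply: eq_bigr => z _; ring.
    move=> fgy; rewrite [X in X ^+ 2](_ : _ = 0) ?expr0n ?mulr0 //.
    by rewrite mulrBr; lra.
  have := bound _ _ fgl2 T0fg [fset x]%fset.
  rewrite mul0r big_seq_fset1 pmulr_rle0 ?mu_gt0 // => fg0.
  apply/eqP; rewrite -subr_eq0 -sqrf_eq0 eq_le fg0; exact: sqr_ge0.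
- move=> g /= gl2.
  have gal2 : l2 G (fun x => g x / a).
    by have /l2P[M /sumsD gM] := gl2; apply/l2P; exists (M / a ^+ 2).
  have [f fl2 fE] := fixpoint_exists r01 gal2; exists f => //.
  by apply/funext => x; exact/eqE.
Qed.

End Resolvent.

(** * Test functions and the bottom of the spectrum *)

Section SpectralBottom.
Context {R : realType} {V : choiceType} (G : weighted_graph R V) (D : R).
Hypotheses (D_gt0 : 0 < D) (degD : forall x, deg G x <= D * mu G x).
Implicit Types (f g : V -> R) (x y : V) (A S : {fset V}).

Local Notation P := (transition G D).
Local Notation sq f := (fun x => f x ^+ 2).

(* With [h = mu f (-Delta f)], contractivity of [P] enters through
   [h^- + D/2 mu f^2 <= h^+ + D/2 mu P(f^2)]. *)
Lemma l2_inner_neg_laplacian_ge0 f : l2 G f ->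
  0 <= l2_inner G (neg_laplacian G f) f.
Proof.
move=> /l2P[M fM]; have f2 x : 0 <= f x ^+ 2 by exact: sqr_ge0.
set h := fun x => mu G x * neg_laplacian G f x * f x.
have mu0 x : 0 <= mu G x by rewrite ltW // mu_gt0.
pose hp x := Num.max (h x) 0; pose hn x := Num.max (- h x) 0.
have hp0 x : 0 <= hp x by rewrite le_max lexx orbT.
have hn0 x : 0 <= hn x by rewrite le_max lexx orbT.
have hpn x : hp x - hn x = h x.
  rewrite /hp /hn; have [h0|h0] := leP 0 (h x).
    by rewrite max_r ?subr0 // oppr_le0.
  by rewrite max_l ?oppr_ge0 ?(ltW h0) // sub0r opprK.
rewrite /l2_inner -/h.
have -> : (esum [set: V] ((fun x => (h x)%:E)^\+)%E = \esum_(x in setT) (hp x)%:E)%E.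
  by apply: eq_esum => x _; rewrite funeposE -EFin_max.
have -> : (esum [set: V] ((fun x => (h x)%:E)^\-)%E = \esum_(x in setT) (hn x)%:E)%E.
  by apply: eq_esum => x _; rewrite funenegE -EFinN -EFin_max.
have LM := l2_neg_laplacian D_gt0 degD fM.
(* From [2 |a b| <= a^2 + b^2], both parts of [h] are summable, so neither [fine] hides an infinite
   value. *)
have bnd (k : V -> R) : (forall x, k x = h x \/ k x = - h x \/ k x = 0) ->
    (\esum_(x in setT) (k x)%:E < +oo)%E.
  move=> kh; have half : 0 <= 2^-1 :> R by rewrite invr_ge0.
  have := @sums_leW _ _ G 2^-1 2^-1 (fun x => k x / mu G x) _ _ _ _ half half _ LM fM.
  move=> kM; apply: le_lt_trans (ltry _); apply/esum_leP => A.
  apply: le_trans (kM _ A); last first.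
    move=> x /=; rewrite ler_pdivrMr ?mu_gt0 //.
    rewrite [leRHS](_ : _ =
      2^-1 * mu G x * (neg_laplacian G f x ^+ 2 + f x ^+ 2)); last by ring.
    have Q0 := mulr_ge0 (mu0 x) (sqr_ge0 (neg_laplacian G f x + f x)).
    have Q1 := mulr_ge0 (mu0 x) (sqr_ge0 (neg_laplacian G f x - f x)).
    have Q2 := mulr_ge0 (mu0 x) (sqr_ge0 (f x)).
    have Q3 := mulr_ge0 (mu0 x) (sqr_ge0 (neg_laplacian G f x)).
    by case: (kh x) => [|[|]] ->; rewrite /h; lra.
  apply: ler_sum => x _; rewrite mulrCA divff ?mulr1 //.
  by rewrite gt_eqF // mu_gt0.
have hp_oo : (\esum_(x in setT) (hp x)%:E < +oo)%E.
  by apply: bnd => x; rewrite /hp; case: leP; auto.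
have hn_oo : (\esum_(x in setT) (hn x)%:E < +oo)%E.
  by apply: bnd => x; rewrite /hn; case: leP; auto.
rewrite subr_ge0 fine_le ?ge0_fin_numE ?esum_ge0 // => [x _|x _|];
  rewrite ?lee_fin //.
pose F x := D / 2 * f x ^+ 2.
have F0 x : 0 <= F x by rewrite mulr_ge0 // ltW // divr_gt0.
have FM : sums_le G F (D / 2 * M + 0 * M).
  by apply: (sums_leW _ (lexx 0) _ fM fM) => [|x]; rewrite ?divr_ge0 ?(ltW D_gt0) ?mul0r ?addr0.
have mF0 x : 0 <= mu G x * F x := mulr_ge0 (mu0 x) (F0 x).
have mPF0 x : 0 <= mu G x * P F x :=
  mulr_ge0 (mu0 x) (transition_ge0 D_gt0 degD x F0).
have aE := esum_mu_sum F0 FM; have := sums_le_mu_sum F0 FM.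
set N := mu_sum G F in aE * => FN.
have bE : (\esum_(x in setT) (mu G x * P F x)%:E <= N%:E)%E.
  by apply/esum_leP; exact: sums_le_transition.
have : ((\esum_(x in setT) (hn x)%:E) + N%:E
    <= (\esum_(x in setT) (hp x)%:E) + N%:E)%E.
  apply: le_trans (leeD2l _ bE); rewrite -aE -!esumD => [|x _|x _|x _|x _];
    rewrite ?lee_fin ?mF0 ?mPF0 //.
  apply: le_esum => x _; rewrite -!EFinD lee_fin.
  have -> : P F x = D / 2 * P (sq f) x.
    have := transition_lin G D (D / 2) 0 0 (sq f) f x.
    rewrite mul0r !addr0 => <-; congr (transition G D _ x).
    by apply/funext => y; rewrite mul0r !addr0.
  have := hpn x; rewrite /h (neg_laplacian_transition G D_gt0) /F => hE.
  (* The difference of the two sides is [D/2 mu ((P(f^2) - (P f)^2) + (f - P f)^2)]. *)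
  have J := mulr_ge0 (mu0 x) (mulr_ge0 (ltW D_gt0)
    (etrans (subr_ge0 _ _) (transition_sqr_le D_gt0 degD f x))).
  have K := mulr_ge0 (mu0 x) (mulr_ge0 (ltW D_gt0) (sqr_ge0 (f x - P f x))).
  lra.
by rewrite leeD2rE.
Qed.

Definition indic S x : R := (x \in S)%:R.

Lemma neg_laplacian_indic S x : x \in S ->
  mu G x * neg_laplacian G (indic S) x =
  \sum_(y <- nb G x | y \notin S) kern G x y.
Proof.
move=> xS; rewrite /neg_laplacian laplacianE mulrN mulrA divff ?mul1r; last first.
  by rewrite gt_eqF // mu_gt0.
rewrite -sumrN [RHS]big_mkcond; apply: eq_bigr => y _.
by rewrite /indic xS; case: (y \in S) => /=; ring.
Qed.

Lemma indic_ge0 S x : 0 <= indic S x.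
Proof. by rewrite /indic ler0n. Qed.

Lemma indic_dirichlet_ge0 S x : 0 <= neg_laplacian G (indic S) x * indic S x.
Proof.
rewrite {2}/indic; have [xS|] := boolP (x \in S); last by rewrite mulr0.
rewrite mulr1 -(pmulr_rge0 _ (mu_gt0 G x)) neg_laplacian_indic //.
by apply: sumr_ge0 => y _; exact: kern_ge0.
Qed.

Lemma indic_dirichlet_sum S :
  mu_sum G (fun x => neg_laplacian G (indic S) x * indic S x)
    = boundary_weight G [set` S].
Proof.
rewrite (@mu_sum_fset _ _ _ _ S) => [|x xS|]; last exact: indic_dirichlet_ge0.
  rewrite boundary_weightE; apply: eq_big_seq => x xS.
  by rewrite {2}/indic xS mulr1 neg_laplacian_indic.
by rewrite {2}/indic (negbTE xS) mulr0.
Qed.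

Lemma indic_sqr_sum S : mu_sum G (sq (indic S)) = volume G [set` S].
Proof.
rewrite (@mu_sum_fset _ _ _ _ S) => [|x xS|x]; last exact: sqr_ge0.
  rewrite volumeE; apply: eq_big_seq => x xS.
  by rewrite /indic xS expr1n mulr1.
by rewrite /indic (negbTE xS) expr0n.
Qed.

Lemma l2_indic S : l2 G (indic S).
Proof.
apply/l2P; exists (\sum_(x <- S) mu G x) => A.
apply: (@le_trans _ _ (\sum_(x <- (S `|` A)%fset) mu G x * indic S x ^+ 2)).
  apply: ler_sum_fset => [|x]; first exact: fsubsetUr.
  by rewrite mulr_ge0 ?sqr_ge0 // ltW // mu_gt0.
rewrite -(@big_fset_incl _ _ _ _ S) ?fsubsetUl // => [|x _ xS].
  rewrite [leLHS]big_seq [leRHS]big_seq ler_sum // => x xS.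
  by rewrite /indic xS expr1n mulr1.
by rewrite /indic (negbTE xS) expr0n mulr0.
Qed.

(** The Rayleigh quotient of the indicator of a finite set is exactly its boundary weight over its
    volume. *)
Lemma rayleigh_inf_le_cheeger : (rayleigh_inf G <= cheeger G)%E.
Proof.
apply: le_ereal_inf_tmp => _ [B [fB [z Bz]] <-].
rewrite -(fset_setK fB); set S := fset_set B.
have zS : z \in S by rewrite in_fset_set //; exact/mem_set.
apply: ereal_inf_lbound; exists (indic S) => /=.
  split; first exact: l2_indic.
  by move=> /(congr1 (fun f => f z)); rewrite /indic zS => /eqP; rewrite oner_eq0.
rewrite l2_innerE; last exact: indic_dirichlet_ge0.
rewrite indic_dirichlet_sum l2_innerE => [|x]; last first.
  by rewrite mulr_ge0 ?indic_ge0.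
by congr ((_ / _)%:E); rewrite -indic_sqr_sum.
Qed.

Lemma rayleigh_inf_ge0 : (0 <= rayleigh_inf G)%E.
Proof.
apply: le_ereal_inf_tmp => _ [f [fl2 _] <-]; rewrite lee_fin divr_ge0 //.
  exact: l2_inner_neg_laplacian_ge0.
rewrite l2_innerE => [|x]; last by rewrite -expr2 sqr_ge0.
by apply: mu_sum_ge0 => x; rewrite -expr2 sqr_ge0.
Qed.

(* [D^2 (f - P f)^2 <= D^2 (P(f^2) - f^2) + 2 D f (-Delta f)] pointwise, and the
   first term on the right sums to something nonpositive. *)
Lemma neg_laplacian_indic_sqr S :
  sums_le G (sq (neg_laplacian G (indic S))) (2 * D * boundary_weight G [set` S]).
Proof.
set f := indic S => A; pose B := (S `|` A)%fset.
have mu0 x : 0 <= mu G x by rewrite ltW // mu_gt0.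
have SB : (S `<=` B)%fset by exact: fsubsetUl.
have f2 x : 0 <= f x ^+ 2 by exact: sqr_ge0.
have fS x : x \notin S -> f x = 0 by rewrite /f /indic => /negbTE ->.
have [M fM] := proj1 (l2P G f) (l2_indic S).
have fN := sums_le_transition_sqr D_gt0 degD (sums_le_mu_sum f2 fM).
set N := mu_sum G (sq f) in fN.
(* Over [B] the sums of [f^2] and of [f (-Delta f)] are complete, both being supported in [S];
   [P(f^2)] may spill outside [B], where only the bound by [N] is needed. *)
have NE : N = \sum_(x <- B) mu G x * f x ^+ 2.
  by apply: mu_sum_fset => // x xB; rewrite fS ?expr0n //;
    apply: contra xB; exact: fsubsetP.
have bwE : boundary_weight G [set` S]
    = \sum_(x <- B) mu G x * (neg_laplacian G f x * f x).
  rewrite -indic_dirichlet_sum; apply: mu_sum_fset => [x xB|]; last first.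
    exact: indic_dirichlet_ge0.
  rewrite -/f (fS x) ?mulr0 //; apply: contra xB; exact: fsubsetP.
apply: (@le_trans _ _ (\sum_(x <- B) mu G x * neg_laplacian G f x ^+ 2)).
  apply: ler_sum_fset => [|x]; first exact: fsubsetUr.
  by rewrite mulr_ge0 ?sqr_ge0.
rewrite bwE; set Q := \sum_(x <- B) mu G x * (_ * _).
apply: (@le_trans _ _ (D ^+ 2 * (\sum_(x <- B) mu G x * P (sq f) x - N) + 2 * D * Q)).
  rewrite NE -sumrB !mulr_sumr -big_split ler_sum // => x _ /=.
  have J := mulr_ge0 (mu0 x) (mulr_ge0 (sqr_ge0 D)
    (etrans (subr_ge0 _ _) (transition_sqr_le D_gt0 degD f x))).
  rewrite (neg_laplacian_transition G D_gt0) -subr_ge0.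
  by rewrite [X in 0 <= X](_ : _ = mu G x * (D ^+ 2 * (P (sq f) x - P f x ^+ 2)));
    last ring.
by rewrite gerDr mulr_ge0_le0 ?sqr_ge0 // subr_le0.
Qed.

(** A bounded inverse at 0, applied to indicators, would give [volume <= C^2 2 D boundary] for all
    finite sets, hence a positive Cheeger constant. The 1 added in [K] keeps it positive. *)
Lemma spectrum0 : cheeger G = 0%E -> spectrum G 0.
Proof.
move=> h0 [_ [C resC]]; pose K := C ^+ 2 * (2 * D) + 1.
have K0 : 0 < K by rewrite ltr_wpDl // mulr_ge0 ?sqr_ge0 // mulr_ge0 // ltW.
suff : ((K^-1)%:E <= cheeger G)%E.
  by rewrite h0 lee_fin leNgt invr_gt0 K0.
apply: le_ereal_inf_tmp => _ [B [fB [z Bz]] <-].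
rewrite -(fset_setK fB); set S := fset_set B.
have zS : z \in S by rewrite in_fset_set //; exact/mem_set.
have S0 : S != fset0 by apply/fset0Pn; exists z.
have v0 : 0 < volume G [set` S] by rewrite volumeE volume_gt0.
rewrite lee_fin ler_pdivlMr // ler_pdivrMl //.
have := resC _ (l2_indic S).
have -> : (fun x => neg_laplacian G (indic S) x - 0 * indic S x)
    = neg_laplacian G (indic S) by apply/funext => x; rewrite mul0r subr0.
rewrite !l2_normE indic_sqr_sum.
have T0 x : 0 <= neg_laplacian G (indic S) x ^+ 2 by exact: sqr_ge0.
have := mu_sum_le T0 (neg_laplacian_indic_sqr S).
have := mu_sum_ge0 G T0; set T := mu_sum G _ => T_ge0 Tbw vT.
have bw0 : 0 <= boundary_weight G [set` S].
  by rewrite -(pmulr_rge0 _ (mulr_gt0 (ltr0Sn R 1) D_gt0)) (le_trans T_ge0).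
have : volume G [set` S] <= C ^+ 2 * T.
  rewrite -[leLHS](sqr_sqrtr (ltW v0)) -[X in _ * X](sqr_sqrtr T_ge0) -exprMn.
  by rewrite lerXn2r ?nnegrE ?sqrtr_ge0 // (le_trans (sqrtr_ge0 _) vT).
move=> /le_trans; apply; rewrite /K mulrDl mul1r.
apply: (@le_trans _ _ (C ^+ 2 * (2 * D * boundary_weight G [set` S]))).
  by rewrite ler_wpM2l ?sqr_ge0.
by rewrite [leLHS]mulrA lerDl.
Qed.

Lemma lambda0_eq0 : cheeger G = 0%E -> lambda0 G = 0%E.
Proof.
move=> h0; apply/eqP; rewrite eq_le; apply/andP; split.
  by apply: ereal_inf_lbound; exists 0 => //; exact: spectrum0.
apply: le_ereal_inf_tmp => _ [l lspec <-]; rewrite lee_fin leNgt.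
by apply/negP => /(negative_resolvent D_gt0 degD).
Qed.

Lemma rayleigh_inf_eq0 : cheeger G = 0%E -> rayleigh_inf G = 0%E.
Proof.
move=> h0; apply/eqP; rewrite eq_le rayleigh_inf_ge0 andbT -h0.
exact: rayleigh_inf_le_cheeger.
Qed.

End SpectralBottom.

(** Both descriptions of the spectral bottom are shown to vanish, each directly from the vanishing
    Cheeger constant. *)
Theorem corollary5p6 (R : realType) (V : choiceType) (G : weighted_graph R V)
    (psi : R -> R) (n : R)
    (hD : (D_mu G < +oo)%E) (hmu : (mu_max G < +oo)%E) (hw : (0 < w_min G)%E)
    (psiC1 : C1_pos psi) (psi_concave : concave_pos psi)
    (psi'1_gt0 : 0 < derive1 psi 1)
    (hH : (H_psi psi < +oo)%E)
    (heta : (limf_esup (fun l : R => (eta_psi psi l / l ^+ 2)%:E) (0 : R)^'+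
             < +oo)%E)
    (n_gt0 : 0 < n) (hCD : CDpsi G psi n 0) :
  cheeger G = 0%E /\ lambda0 G = 0%E /\ rayleigh_inf G = 0%E.
Proof.
have h0 : cheeger G = 0%E.
  apply: cheeger_eq0 => h.
  exact: (CDpsi_no_isoperimetric hD hmu hw psiC1 psi_concave psi'1_gt0 n_gt0).
have [D D0 degD] := ereal_sup_lty_bound hD.
have {}degD x : deg G x <= D * mu G x by rewrite -ler_pdivrMr ?mu_gt0.
by split=> //; split; [exact: (lambda0_eq0 D0) | exact: (rayleigh_inf_eq0 D0)].
Qed.
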